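(* Let $\alpha>0$. There exists a holonomic discounted stationary Mather measure; that is, there exist a probability measure $\nu$ on $\Omega$ and a discounted stationary Mather measure $\mu$ on $\mathbb{R}^n\times\Omega$ with trace $\nu$ such that $$\int_{\mathbb{R}^n\times\Omega}\varphi(0,\omega)\,d\mu(v,\omega)=\int_\Omega\varphi(0,\omega)\,d\nu(\omega)\qquad\text{for all }\varphi\in C^1_s(\mathbb{R}^n\times\Omega).$$
   Context: Setting. $(\Omega,d)$ is a compact metric space on which $\mathbb{R}^n$ acts continuously by $(x,\omega)\mapsto\tau_x\omega$, with $\tau_{x+y}\omega=\tau_x\tau_y\omega$, $\tau_0=\mathrm{Id}$. The action is uniformly transitive: for every $\varepsilon>0$ there is $M>0$ such that for all $\omega_1,\omega_2\in\Omega$ there is $z\in\mathbb{R}^n$ with $|z|<M$ and $d(\tau_z\omega_1,\omega_2)<\varepsilon$. The Lagrangian $L=L(x,v,\omega):\mathbb{R}^n\times\mathbb{R}^n\times\Omega\to\mathbb{R}$ is continuous, $C^3$ in $(x,v)$, strictly convex and superlinear in $v$, nonnegative, satisfies $L(x+y,v,\omega)-L(x,v,\omega)\le |y|(C+C\,L(x,v,\omega))$ for some constant $C$ and all $x,y,v,\omega$, and is stationary: $L(x+y,v,\omega)=L(x,v,\tau_y\omega)$. A function $\varphi:\mathbb{R}^n\times\Omega\to\mathbb{R}$ is stationary if $\varphi(x+y,\omega)=\varphi(x,\tau_y\omega)$ for all $x,y,\omega$. $C^1_s(\mathbb{R}^n\times\Omega)$ is the set of stationary $\varphi$ that are $C^1$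 in $x$, continuous in $\omega$, and such that $\omega\mapsto D_x\varphi(0,\omega)$ is continuous. Discounted Mather measures. Given $\alpha>0$ and a probability measure $\nu$ on $\Omega$, a discounted stationary Mather measure with trace $\nu$ is a probability measure $\mu$ on $\mathbb{R}^n\times\Omega$ minimizing $\int L(0,v,\omega)\,d\mu(v,\omega)$ among probability measures satisfying $\int (v\cdot D_x\varphi(0,\omega)-\alpha\varphi(0,\omega))\,d\mu=-\alpha\int_\Omega\varphi(0,\omega)\,d\nu$ for all $\varphi\in C^1_s(\mathbb{R}^n\times\Omega)$. *)

(* Defs.v *)
(* MathComp-Analysis. *)
From HB Require Import structures.
From mathcomp Require Import all_boot all_order all_algebra.
From mathcomp Require Import all_classical all_reals all_analysis.
Import Order.TTheory GRing.Theory Num.Theory.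
Import numFieldNormedType.Exports.

Set Implicit Arguments.
Unset Strict Implicit.
Unset Printing Implicit Defensive.

Local Open Scope classical_set_scope.
Local Open Scope ring_scope.

(* Nonempty metric spaces: [measurableType] asks for a distinguished point, on
   which nothing below depends. *)
#[short(type="pmetricType")]
HB.structure Definition PointedMetric (K : numDomainType) :=
  { M of Metric K M & Pointed M }.

(* [T] with its Borel sigma-algebra. *)
Notation borel T := (g_sigma_algebraType (@open T)).

Section Euclidean.
Context {R : realType} {n : nat}.

Definition dotv (v w : 'rV[R]_n) : R := \sum_(i < n) v ord0 i * w ord0 i.

(* The library norm on ['rV[R]_n] is the sup norm. *)
Definition enorm (v : 'rV[R]_n) : R := Num.sqrt (dotv v v).

Definition grad (f : 'rV[R]_n -> R) (x : 'rV[R]_n) : 'rV[R]_n :=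
  \row_(i < n) 'D_(delta_mx ord0 i) f x.

End Euclidean.

(* [C^k] on a finite-dimensional space: in finite dimension, continuity of all
   the directional derivatives amounts to continuity of the differential. *)
Fixpoint Ck {R : realType} {V : normedModType R} (k : nat) (f : V -> R) : Prop :=
  if k is k'.+1 then
    (forall x, differentiable f x) /\ (forall v, Ck k' (fun x => 'D_v f x))
  else continuous f.

Section Setting.
Context {R : realType} {n : nat} {Omega : pmetricType R}.
Local Notation V := 'rV[R]_n.

Definition continuous_action (tau : V -> Omega -> Omega) : Prop :=
  [/\ continuous (fun p : V * Omega => tau p.1 p.2),
      forall x y w, tau (x + y) w = tau x (tau y w)
    & forall w, tau 0 w = w].

Definition uniformly_transitive (tau : V -> Omega -> Omega) : Prop :=
  forall eps : R, 0 < eps -> exists2 M : R, 0 < M &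
    forall w1 w2 : Omega, exists z : V,
      enorm z < M /\ mdist (tau z w1) w2 < eps.

Record lagrangian (tau : V -> Omega -> Omega) (L : V -> V -> Omega -> R)
    : Prop := {
  lag_continuous : continuous (fun p : V * V * Omega => L p.1.1 p.1.2 p.2);
  lag_C3 : forall w, Ck 3 (fun p : V * V => L p.1 p.2 w);
  lag_strictly_convex : forall x w v1 v2 (t : R), v1 != v2 -> 0 < t < 1 ->
    L x (t *: v1 + (1 - t) *: v2) w < t * L x v1 w + (1 - t) * L x v2 w;
  lag_superlinear : forall x w (A : R), exists2 r : R, 0 < r &
    forall v, r <= enorm v -> A <= L x v w / enorm v;
  lag_ge0 : forall x v w, 0 <= L x v w;
  lag_growth : exists C : R, forall x y v w,
    L (x + y) v w - L x v w <= enorm y * (C + C * L x v w);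
  lag_stationary : forall x y v w, L (x + y) v w = L x v (tau y w) }.

Record C1s (tau : V -> Omega -> Omega) (phi : V -> Omega -> R) : Prop := {
  C1s_stationary : forall x y w, phi (x + y) w = phi x (tau y w);
  C1s_C1 : forall w, Ck 1 (phi^~ w);
  C1s_continuous : forall x, continuous (phi x);
  C1s_grad_continuous : continuous (fun w => grad (phi^~ w) 0) }.

(* The integrability clause makes the left-hand integral meaningful: [v] is
   unbounded, so an arbitrary probability measure need not integrate [v . D phi].
   The other integrand, [phi 0], is continuous on the compact space [Omega]. *)
Definition discounted_constraint (tau : V -> Omega -> Omega) (alpha : R)
    (nu : probability (borel Omega) R)
    (mu : probability (borel (V * Omega)%type) R) : Prop :=
  forall phi, C1s tau phi ->
    let F := fun p : V * Omega =>
      (dotv p.1 (grad (phi^~ p.2) 0) - alpha * phi 0 p.2)%:E in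
    mu.-integrable setT F /\
    (\int[mu]_p F p = (- alpha)%:E * \int[nu]_w (phi 0 w)%:E)%E.

Definition action_value (L : V -> V -> Omega -> R)
    (mu : probability (borel (V * Omega)%type) R) : \bar R :=
  (\int[mu]_p (L 0 (p : V * Omega).1 (p : V * Omega).2)%:E)%E.

Definition discounted_mather (tau : V -> Omega -> Omega)
    (L : V -> V -> Omega -> R) (alpha : R)
    (nu : probability (borel Omega) R)
    (mu : probability (borel (V * Omega)%type) R) : Prop :=
  discounted_constraint tau alpha nu mu /\
  forall mu' : probability (borel (V * Omega)%type) R,
    discounted_constraint tau alpha nu mu' ->
    (action_value L mu <= action_value L mu')%E.

End Setting.

(* Main.v *)
Require Import Defs.
From HB Require Import structures.
From mathcomp Require Import all_boot all_order all_algebra.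
From mathcomp Require Import all_classical all_reals all_analysis.
From mathcomp Require Import measurable_realfun ring lra.
Import Order.TTheory GRing.Theory Num.Theory.
Import numFieldNormedType.Exports.

(* Let [u] be the supremum of all subsolutions of [alpha w - v . D w <= L],
   written in finite-increment form so that suprema of subsolutions are again
   subsolutions.  Perturbing [u] along orbits shows that it is continuous on
   [Omega].  Averaging [u] along the flow in each coordinate direction gives
   test functions [phi] close to [u] with [alpha phi - v . D phi <= L + e];
   hence every admissible measure with trace [nu] has action at least the
   integral of [alpha u] against [nu].  It remains to find a holonomic measure
   that attains this bound for its own projection, i.e. one that annihilates
   all [v . D phi] and gives [L - alpha u] a nonpositive integral.
   By Hahn-Banach and Riesz such a measure exists unless
   [alpha u + c - v . D psi <= L] for some [c > 0] and some [psi], and then a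
   translate of [psi] would be a subsolution exceeding [u] somewhere. *)

Set Implicit Arguments.
Unset Strict Implicit.
Unset Printing Implicit Defensive.

Local Open Scope classical_set_scope.
Local Open Scope ring_scope.

(** Velocities are unbounded, so compactness is available only where [|v| <= rad]: subsolutions are
    tested there, the Hahn-Banach functional is positive relative to that set, and the measure is
    carried by it. The radius comes from superlinearity made uniform in [w]: testing velocities of
    norm at most 1 bounds the gradient of a smoothed subsolution, and beyond [rad] the growth of [L]
    beats that gradient, so the inequality extends to all [v]. The increment form must admit
    translates of a [psi] that satisfies only a pointwise differential inequality. Passing from a
    derivative to an increment of length [t] costs an error of order [t ^ 2], due to the variation
    of [L] and [u] along the segment; the term [M * t ^ 2] absorbs it, and disappears after division
    by [t] as [t] tends to 0. The variation of [u] depends in turn on [M], but only with the factor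
    [alpha * t0 = 1 / 2], so that [M = 2 * (ML + alpha * CL)] closes the loop. The functions
    [v . D phi] are unbounded, hence the Riesz theorem is proved for all continuous functions on a
    space that need not be compact, with a functional that is monotone relative to a compact
    subset. *)

(** * Continuity and compactness *)

Lemma continuous_pair {T U W : topologicalType} (f : T -> U) (g : T -> W) :
  continuous f -> continuous g -> continuous (fun x => (f x, g x)).
Proof. by move=> cf cg x; exact: (cvg_pair (cf x) (cg x)). Qed.

Lemma continuous_compose {T U W : topologicalType} (f : T -> U) (g : U -> W) :
  continuous f -> continuous g -> continuous (fun x => g (f x)).
Proof. by move=> cf cg x; apply: (@continuous_comp _ _ _ f g); [exact: cf|exact: cg]. Qed.

Lemma continuous_add {R : realType} {T : topologicalType} (f g : T -> R) :
  continuous f -> continuous g -> continuous (fun x => f x + g x).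
Proof. by move=> cf cg x; apply: cvgD; [exact: cf|exact: cg]. Qed.

Lemma continuous_sub {R : realType} {T : topologicalType} (f g : T -> R) :
  continuous f -> continuous g -> continuous (fun x => f x - g x).
Proof. by move=> cf cg x; apply: cvgB; [exact: cf|exact: cg]. Qed.

Lemma continuous_mul {R : realType} {T : topologicalType} (f g : T -> R) :
  continuous f -> continuous g -> continuous (fun x => f x * g x).
Proof. by move=> cf cg x; apply: cvgM; [exact: cf|exact: cg]. Qed.

Lemma continuous_id {T : topologicalType} : continuous (fun x : T => x).
Proof. by move=> x; exact: cvg_id. Qed.

Lemma compact_bounded_above {R : realType} {T : topologicalType} (K : set T) (f : T -> R) :
  compact K -> continuous f -> exists2 c : R, 0 <= c & forall x, K x -> `|f x| <= c.
Proof.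
move=> cK cf.
have : \forall j \near \oo, K `<=` [set x | `|f x| <= j%:R].
  apply: (proj1 (compact_near_coveringP K) cK) => x Kx.
  have : \forall x' \near x, `|f x'| < `|f x| + 1.
    have /cvgr_lt : `|f x'| @[x' --> x] --> `|f x| by apply: cvg_norm; exact: cf.
    by apply; rewrite ltrDl.
  move=> nx; near=> x' j => /=.
  apply: (@le_trans _ _ (`|f x| + 1)).
    by apply: ltW; near: x'.
  by near: j; exact: nbhs_infty_ger.
by move=> [N _ /(_ N (leqnn N)) hN]; exists N%:R.
Unshelve. all: by end_near. Qed.

(** The covering form of compactness merges the product neighbourhoods of the points [(s, x)] into a
    single neighbourhood of [s]. Most uniform estimates below come from this lemma. *)
Lemma compact_tube {R : realType} {S T : topologicalType} (K : set T)
    (F : S * T -> R) (s : S) (e : R) : compact K -> continuous F -> 0 < e ->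
  \forall s' \near s, forall x, K x -> `|F (s', x) - F (s, x)| < e.
Proof.
move=> cK cF e0.
apply: (proj1 (compact_near_coveringP K) cK) => x Kx.
have e20 : 0 < e / 2 by rewrite divr_gt0.
have := cF (s, x); move/cvgrPdist_lt => /(_ _ e20) [[A B]] /= [As Bx] AB.
exists (B, A) => //= -[x' s'] /= [Bx' As'].
have h1 := AB (s', x') (conj As' Bx').
have h2 := AB (s, x') (conj (nbhs_singleton As) Bx').
rewrite (splitr e) distrC; apply: le_lt_trans (ltrD h2 h1).
rewrite /= [X in _ <= X + _]distrC.
by apply: le_trans (ler_normD _ _); rewrite subrKA.
Qed.

(** * The Hahn-Banach theorem *)

Section HahnBanach.
Context {R : realType} {E : lmodType R} (P : set E).
Hypothesis P0 : P 0.
Hypothesis PD : forall a f g, P f -> P g -> P (a *: f + g).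

(** The subspace is a predicate [P] on [E], because it will be the continuous functions among all
    functions; functionals are total and constrained on [P] only. Homogeneity is asked for positive
    factors, and the value at 0 follows. *)
Definition sublinear (q : E -> R) : Prop :=
  (forall f g, P f -> P g -> q (f + g) <= q f + q g) /\
  (forall a f, 0 < a -> P f -> q (a *: f) = a * q f).

Let PA f g : P f -> P g -> P (f + g).
Proof. by move=> Pf Pg; rewrite -[f]scale1r; exact: PD. Qed.

Let PZ a f : P f -> P (a *: f).
Proof. by move=> Pf; rewrite -[_ *: _]addr0; exact: PD. Qed.

Let PN f : P f -> P (- f).
Proof. by move=> Pf; rewrite -scaleN1r; exact: PZ. Qed.

Lemma sublinear0 q : sublinear q -> q 0 = 0.
Proof.
move=> [_ /(_ 2 0 (ltr0Sn _ 1) P0)]; rewrite scaler0 => h.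
by move: h; lra.
Qed.

Lemma sublinear_ge_opp q f : sublinear q -> P f -> - q (- f) <= q f.
Proof.
move=> sq Pf; have := sq.1 f (- f) Pf (PN Pf).
by rewrite subrr sublinear0//; lra.
Qed.

(** The pointwise infimum of the chain works; it is finite because every member lies above
    [- p (- f)]. *)
Lemma sublinear_chain (p : E -> R) (A : set (E -> R)) : A !=set0 ->
  (forall q, A q -> sublinear q /\ forall f, P f -> q f <= p f) ->
  (forall q r, A q -> A r ->
    (forall f, P f -> q f <= r f) \/ (forall f, P f -> r f <= q f)) ->
  exists q, [/\ sublinear q, forall f, P f -> q f <= p f &
    forall r, A r -> forall f, P f -> q f <= r f].
Proof.
move=> [q0 Aq0] subA totA.
pose S f : set R := [set q f | q in A].
have Slb f : P f -> lbound (S f) (- p (- f)).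
  move=> Pf _ [q /subA[sq qp] <-].
  apply: le_trans (sublinear_ge_opp sq Pf).
  by rewrite lerN2; apply: qp; exact: PN.
have hS f : P f -> has_inf (S f).
  move=> Pf; split; first by exists (q0 f), q0.
  by exists (- p (- f)); exact: Slb.
have infle q f : A q -> P f -> inf (S f) <= q f.
  move=> Aq Pf; apply: ge_inf; first by case: (hS f Pf).
  by exists q.
have lub f y : P f -> (forall q, A q -> y <= q f) -> y <= inf (S f).
  by move=> Pf h; apply: lb_le_inf; [exact: (hS f Pf).1|move=> _ [q Aq <-]; exact: h].
exists (fun f => inf (S f)); split.
- split.
    move=> f g Pf Pg.
    (* Two different members of the chain may be nearly optimal for [f] and for [g]; being
       comparable, the smaller of the two serves for both. *)
    suff h q r : A q -> A r -> inf (S (f + g)) <= q f + r g.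
      rewrite -lerBlDr; apply: (lub _) => // q Aq.
      rewrite lerBlDr -lerBlDl; apply: (lub _) => // r Ar.
      by rewrite lerBlDl; exact: h.
    move=> Aq Ar.
    have [qr|rq] := totA _ _ Aq Ar.
      apply: le_trans (infle q _ Aq (PA Pf Pg)) _.
      apply: le_trans ((subA _ Aq).1.1 f g Pf Pg) _.
      by rewrite lerD2l; exact: qr.
    apply: le_trans (infle r _ Ar (PA Pf Pg)) _.
    apply: le_trans ((subA _ Ar).1.1 f g Pf Pg) _.
    by rewrite lerD2r; exact: rq.
  move=> a f a0 Pf; apply/eqP; rewrite eq_le; apply/andP; split.
    rewrite mulrC -ler_pdivrMr//; apply: (lub _) => // q Aq.
    rewrite ler_pdivrMr// mulrC -(subA _ Aq).1.2//.
    by apply: infle => //; exact: PZ.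
  apply: (lub _); first exact: PZ.
  move=> q Aq; rewrite (subA _ Aq).1.2// ler_pM2l//; exact: infle.
- by move=> f Pf; apply: le_trans (infle q0 _ Aq0 Pf) _; exact: (subA _ Aq0).2.
- by move=> r Ar f Pf; exact: infle.
Qed.

(** The functional [r x = inf_(t >= 0) (q (x + t y) - t q y)] is sublinear and below [q], so
    minimality gives [q <= r]; at [x = - y] the choice [t = 1] then yields [q (- y) <= - q y]. *)
Lemma minimal_sublinear_opp q : sublinear q ->
  (forall r, sublinear r -> (forall f, P f -> r f <= q f) ->
    forall f, P f -> q f <= r f) ->
  forall y, P y -> q (- y) = - q y.
Proof.
move=> sq minq y Py.
pose S x : set R := [set q (x + t *: y) - t * q y | t in [set t | 0 <= t]].
have Slb x : P x -> lbound (S x) (- q (- x)).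
  move=> Px _ [t /= t0 <-].
  have [->|tn0] := eqVneq t 0.
    by rewrite scale0r mul0r addr0 subr0; exact: sublinear_ge_opp.
  have t1 : 0 < t by rewrite lt_neqAle eq_sym tn0.
  rewrite lerBrDr -(sq.2 t y)// addrC lerBlDr.
  rewrite [X in q X <= _](_ : _ = (x + t *: y) + - x); last first.
    by rewrite addrC addrA addNr add0r.
  apply: sq.1; last exact: PN.
  by apply: PA => //; exact: PZ.
have hS x : P x -> has_inf (S x).
  move=> Px; split; last by exists (- q (- x)); exact: Slb.
  by exists (q (x + 0 *: y) - 0 * q y), 0 => /=.
have infle x t : P x -> 0 <= t -> inf (S x) <= q (x + t *: y) - t * q y.
  by move=> Px t0; apply: ge_inf; [case: (hS x Px)|exists t].
have lub x z : P x -> (forall t, 0 <= t -> z <= q (x + t *: y) - t * q y) ->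
    z <= inf (S x).
  by move=> Px h; apply: lb_le_inf; [exact: (hS x Px).1|move=> _ [t t0 <-]; exact: h].
have sr : sublinear (fun x => inf (S x)).
  split=> [f g Pf Pg|a f a0 Pf].
    suff h s t : 0 <= s -> 0 <= t -> inf (S (f + g)) <=
        (q (f + s *: y) - s * q y) + (q (g + t *: y) - t * q y).
      rewrite -lerBlDr; apply: (lub _) => // s s0.
      rewrite lerBlDr -lerBlDl; apply: (lub _) => // t t0.
      by rewrite lerBlDl; exact: h.
    move=> s0 t0.
    apply: le_trans (infle _ (s + t) (PA Pf Pg) (addr_ge0 s0 t0)) _.
    have := sq.1 _ _ (PA Pf (PZ s Py)) (PA Pg (PZ t Py)).
    by rewrite addrACA -scalerDl; lra.
  apply/eqP; rewrite eq_le; apply/andP; split.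
    rewrite mulrC -ler_pdivrMr//; apply: (lub _) => // t t0.
    rewrite ler_pdivrMr// mulrC mulrBr -(sq.2 a _ a0 (PA Pf (PZ t Py))).
    rewrite scalerDr scalerA mulrA.
    by apply: infle; [exact: PZ|rewrite mulr_ge0// ltW].
  apply: (lub _); first exact: PZ.
  move=> t t0.
  have -> : a *: f + t *: y = a *: (f + (t / a) *: y).
    by rewrite scalerDr scalerA mulrCA divff ?gt_eqF// mulr1.
  rewrite (sq.2 a _ a0 (PA Pf (PZ _ Py))).
  have -> : t * q y = a * ((t / a) * q y).
    by rewrite mulrA mulrCA divff ?gt_eqF// mulr1.
  by rewrite -mulrBr ler_pM2l//; apply: infle => //; rewrite divr_ge0// ltW.
have rq f : P f -> inf (S f) <= q f.
  by move=> Pf; apply: le_trans (infle f 0 Pf (lexx _)) _; rewrite scale0r addr0 mul0r subr0.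
have := minq _ sr rq (- y) (PN Py).
move=> /le_trans/(_ (infle (- y) 1 (PN Py) ler01)).
rewrite scale1r addNr sublinear0// mul1r sub0r => le1.
apply/eqP; rewrite eq_le le1/=.
by rewrite lerNl; exact: sublinear_ge_opp.
Qed.

(** A minimal sublinear functional below [p] exists by Zorn's lemma, and minimality makes it odd,
    hence linear on [P]. *)
Theorem hahn_banach_sublinear (p : E -> R) : sublinear p ->
  exists q : E -> R,
    (forall a f g, P f -> P g -> q (a *: f + g) = a * q f + q g) /\
    (forall f, P f -> q f <= p f).
Proof.
move=> sp.
pose T := {q : E -> R | sublinear q /\ forall f, P f -> q f <= p f}.
(* The order is reversed, since Zorn's lemma delivers maximal elements. *)
pose Rel (q r : T) := `[< forall f, P f -> sval r f <= sval q f >].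
have [||A totA|[q [sq qp]] maxq] := @ZL_preorder T (exist _ p (conj sp (fun f _ => lexx _))) Rel.
- by move=> t; apply/asboolP.
- move=> r s t /asboolP rs /asboolP st; apply/asboolP => f Pf.
  by apply: le_trans (st f Pf) _; exact: rs.
- have [[q0 Aq0]|nA] := pselect (A !=set0); last first.
    exists (exist _ p (conj sp (fun f _ => lexx _))) => s As.
    by exfalso; apply: nA; exists s.
  have [|||q [sq qp qA]] := @sublinear_chain p [set sval q | q in A].
  + by exists (sval q0), q0.
  + by move=> _ [q _ <-]; exact: (svalP q).
  + move=> _ _ [r Ar <-] [r' Ar' <-].
    by have [/asboolP|/asboolP] := totA _ _ Ar Ar'; [right|left].
  exists (exist _ q (conj sq qp)) => s As.
  by apply/asboolP => f Pf /=; apply: qA => //; exists s.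
have minq r : sublinear r -> (forall f, P f -> r f <= q f) ->
    forall f, P f -> q f <= r f.
  move=> sr rq.
  have rp f : P f -> r f <= p f by move=> Pf; apply: le_trans (rq f Pf) (qp f Pf).
  have := maxq (exist _ r (conj sr rp)).
  by move=> h; apply/asboolP/h/asboolP.
have qN := minimal_sublinear_opp sq minq.
exists q; split => //.
have qD f g : P f -> P g -> q (f + g) = q f + q g.
  move=> Pf Pg; apply/eqP; rewrite eq_le sq.1//=.
  have := sq.1 (f + g) (- g) (PA Pf Pg) (PN Pg).
  by rewrite addrK qN//; lra.
have qZ a f : P f -> q (a *: f) = a * q f.
  move=> Pf; have [a0|a0|->] := ltgtP a 0; last by rewrite scale0r sublinear0// mul0r.
    have na0 : 0 < - a by rewrite oppr_gt0.
    have := sq.2 _ _ na0 Pf; rewrite scaleNr qN; last exact: PZ.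
    by rewrite mulNr => /oppr_inj.
  by rewrite sq.2.
by move=> a f g Pf Pg; rewrite qD ?qZ//; exact: PZ.
Qed.

(** Here [A f] plays the role of a set of admissible upper bounds of [f]. Only one inequality of
    homogeneity needs a proof: the other is the same one for the factor [c^-1]. *)
Lemma inf_sublinear (A : E -> set R) : (forall f, P f -> has_inf (A f)) ->
  (forall f g a b, P f -> P g -> A f a -> A g b -> A (f + g) (a + b)) ->
  (forall c f a, 0 < c -> P f -> A f a -> A (c *: f) (c * a)) ->
  sublinear (fun f => inf (A f)).
Proof.
move=> hA AD AZ.
have lb f a : P f -> A f a -> inf (A f) <= a.
  by move=> Pf Afa; apply: ge_inf => //; exact: (hA f Pf).2.
split=> [f g Pf Pg|c f c0 Pf].
  rewrite -lerBlDr; apply: lb_le_inf; first exact: (hA f Pf).1.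
  move=> a Aa; rewrite lerBlDr -lerBlDl; apply: lb_le_inf; first exact: (hA g Pg).1.
  move=> b Ab; rewrite lerBlDl; apply: lb; first exact: PA.
  exact: AD.
have Zle k h : 0 < k -> P h -> inf (A (k *: h)) <= k * inf (A h).
  move=> k0 Ph; rewrite mulrC -ler_pdivrMr//.
  apply: lb_le_inf; first exact: (hA h Ph).1.
  move=> a Aa; rewrite ler_pdivrMr// mulrC; apply: lb; first exact: PZ.
  exact: AZ.
apply/eqP; rewrite eq_le Zle//=.
have := Zle c^-1 (c *: f); rewrite invr_gt0 => /(_ c0 (PZ c Pf)).
by rewrite scalerA mulVf ?gt_eqF// scale1r ler_pdivlMl.
Qed.

End HahnBanach.

(** * The Riesz representation theorem *)

(** With [r x] the supremum of the radii of balls around [x] inside [O], a 1-Lipschitz substitute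
    for the distance to the complement, the functions [min 1 (j * r)] increase to the indicator of
    [O]. *)
Lemma open_exhaustion {R : realType} {T : pseudoMetricType R} (O : set T) :
  open O -> exists g : nat -> T -> R,
    [/\ forall j, continuous (g j), forall j x, 0 <= g j x <= 1,
        forall j x, g j x <= g j.+1 x, forall j x, ~ O x -> g j x = 0
      & forall x, O x -> exists j, g j x = 1].
Proof.
move=> oO.
(* The element 0 gives [r = 0] outside [O]; the cap 1 keeps [r] finite when [O] is the whole
   space. *)
pose S x : set R := [set e | e = 0 \/ 0 < e <= 1 /\ ball x e `<=` O].
have hS x : has_sup (S x).
  split; first by exists 0; left.
  by exists 1 => e [->|[/andP[]]].
pose r x := sup (S x).
have r_ub x e : S x e -> e <= r x.
  by move=> Se; apply: ub_le_sup => //; exact: (hS x).2.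
have r_ge0 x : 0 <= r x by apply: r_ub; left.
have r_lip x y d : 0 < d -> ball x d y -> r x <= r y + d.
  move=> d0 xy; apply: ge_sup; first exact: (hS x).1.
  move=> e [->|[/andP[e0 e1] eO]]; first by rewrite addr_ge0// ltW.
  have [ed|de] := leP e d; first by rewrite (le_trans ed)// lerDr.
  rewrite -lerBlDr; apply: r_ub; right; split.
    by rewrite subr_gt0 de/= (le_trans _ e1)// gerBl ltW.
  move=> z yz; apply: eO; rewrite -(subrK d e) addrC.
  exact: ball_triangle yz.
have r_cont : continuous r.
  move=> x; apply/cvgrPdist_le => e e0; near=> y.
  have xy : ball x e y by near: y; exact: nbhsx_ballx.
  have := r_lip _ _ _ e0 xy; have := r_lip _ _ _ e0 (ball_sym xy).
  by rewrite ler_distl; lra.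
exists (fun j x => Num.min 1 (j%:R * r x)); split.
- move=> j x; apply: (@continuous_min _ _ (fun=> 1) (fun x => j%:R * r x)); first exact: cvg_cst.
  by apply: cvgM; [exact: cvg_cst|exact: r_cont].
- by move=> j x; rewrite le_min ler01 ge_min lexx/= mulr_ge0.
- move=> j x; rewrite le_min ge_min lexx/= ge_min; apply/orP; right.
  by apply: ler_wpM2r => //; rewrite ler_nat.
- move=> j x nOx; suff -> : r x = 0 by rewrite mulr0; apply/min_idPr.
  apply/eqP; rewrite eq_le r_ge0 andbT; apply: ge_sup; first exact: (hS x).1.
  move=> e [->//|[/andP[e0 _] /(_ x)]].
  by move=> /(_ (@ball_center _ _ x (PosNum e0))).
- move=> x Ox.
  have rx : 0 < r x.
    have /nbhs_ballP[e /= e0 eO] : nbhs x O by exact: open_nbhs_nbhs.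
    have m0 : 0 < Num.min e 1 by rewrite lt_min e0 ltr01.
    apply: lt_le_trans (m0) _; apply: r_ub; right; split.
      by rewrite m0/= ge_min lexx orbT.
    apply: subset_trans eO; apply: le_ball; by rewrite ge_min lexx.
  exists (Num.truncn (r x)^-1).+1; apply/min_idPl.
  rewrite -ler_pdivrMr// div1r ltW//.
  by rewrite truncnS_gt// invr_ge0 ltW.
Unshelve. all: by end_near. Qed.

Lemma continuous_borel_measurable {R : realType} {T : ptopologicalType} (f : T -> R) :
  continuous f -> measurable_fun [set: borel T] (f : borel T -> R).
Proof.
move=> cf; apply: (measurability _ (RGenOInfty.measurableE R)).
move=> _ [_ [a ->] <-]; rewrite setTI.
apply: sub_sigma_algebra; have /continuousP := cf; apply.
exact: interval_open.
Qed.

Lemma bounded_continuous_integrable {R : realType} {T : ptopologicalType}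
    (P : probability (borel T) R) (f : T -> R) (c : R) :
  continuous f -> (forall x, `|f x| <= c) ->
  P.-integrable [set: borel T] (EFin \o (f : borel T -> R)).
Proof.
move=> cf fc; apply: measurable_bounded_integrable => //.
- by apply: le_lt_trans (probability_le1 P measurableT) _; rewrite ltry.
- exact: continuous_borel_measurable.
- by exists c; split; [exact: num_real|move=> M cM x _ /=; exact: le_trans (ltW cM)].
Qed.

Section Riesz.
Context {R : realType} {T : ptopologicalType}.
Variables (Lam : (T -> R) -> R) (X : set T).
Hypothesis X_compact : compact X.
Hypothesis exhaustion : forall O : set T, open O -> exists g : nat -> T -> R,
    [/\ forall j, continuous (g j), forall j x, 0 <= g j x <= 1,
        forall j x, g j x <= g j.+1 x, forall j x, ~ O x -> g j x = 0
      & forall x, O x -> exists j, g j x = 1].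
Hypothesis Lam_linear : forall (a : R) (f g : T -> R), continuous f -> continuous g ->
  Lam (fun x => a * f x + g x) = a * Lam f + Lam g.
Hypothesis Lam_le : forall f g : T -> R, continuous f -> continuous g ->
  (forall x, X x -> f x <= g x) -> Lam f <= Lam g.
Hypothesis Lam1 : Lam (fun=> 1) = 1.

Let cst_cont (a : R) : continuous (fun _ : T => a).
Proof. exact: cst_continuous. Qed.

Let Lam0 : Lam (fun=> 0) = 0.
Proof.
have := Lam_linear 1 (@cst_cont 0) (@cst_cont 0).
have -> : (fun _ : T => 1 * 0 + 0 : R) = (fun=> 0) by apply/funext => x; ring.
by lra.
Qed.

Let LamD (f g : T -> R) : continuous f -> continuous g ->
  Lam (fun x => f x + g x) = Lam f + Lam g.
Proof.
move=> cf cg; have := Lam_linear 1 cf cg.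
have -> : (fun x => 1 * f x + g x) = (fun x => f x + g x).
  by apply/funext => x; ring.
by rewrite mul1r.
Qed.

Let LamZ (a : R) (f : T -> R) : continuous f -> Lam (fun x => a * f x) = a * Lam f.
Proof.
move=> cf; have := Lam_linear a cf (@cst_cont 0).
have -> : (fun x => a * f x + 0) = (fun x => a * f x).
  by apply/funext => x; ring.
by rewrite Lam0 addr0.
Qed.

Let LamB (f g : T -> R) : continuous f -> continuous g ->
  Lam (fun x => f x - g x) = Lam f - Lam g.
Proof.
move=> cf cg; have := Lam_linear (- 1) cg cf.
have -> : (fun x => -1 * g x + f x) = (fun x => f x - g x).
  by apply/funext => x; ring.
by move=> ->; ring.
Qed.

Let Lam_cst c : Lam (fun=> c) = c.
Proof.
transitivity (Lam (fun=> c * 1)); first by rewrite mulr1.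
by rewrite (LamZ c (@cst_cont 1)) Lam1 mulr1.
Qed.

Let Lam_sum (h : nat -> T -> R) n : (forall i, continuous (h i)) ->
  continuous (fun x => \sum_(0 <= i < n) h i x) /\
  Lam (fun x => \sum_(0 <= i < n) h i x) = \sum_(0 <= i < n) Lam (h i).
Proof.
move=> ch; elim: n => [|n [cn IHn]].
  have -> : (fun x => \sum_(0 <= i < 0) h i x) = (fun=> 0).
    by apply/funext => x; rewrite big_geq.
  by rewrite big_geq.
have -> : (fun x => \sum_(0 <= i < n.+1) h i x) =
    (fun x => \sum_(0 <= i < n) h i x + h n x).
  by apply/funext => x; rewrite big_nat_recr.
by rewrite LamD// IHn big_nat_recr//=; split => //; exact: continuous_add.
Qed.

(* The increasing sequence [h] stands for the lower semicontinuous function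
   [sup_j h j]: with such covers, countable subadditivity and the Caratheodory
   property of open sets need no double series. *)
Definition function_cover (A : set T) (c : R) : Prop :=
  exists h : nat -> T -> R,
    [/\ forall j, continuous (h j), forall j x, 0 <= h j x,
        forall j x, h j x <= h j.+1 x, forall j, Lam (h j) <= c
      & forall x, A x -> X x -> exists j, 1 <= h j x].

Definition functional_outer (A : set T) : \bar R :=
  ereal_inf [set c%:E | c in function_cover A].
Local Notation mu := functional_outer.

Let cover_ge0 A c : function_cover A c -> 0 <= c.
Proof.
move=> [h [ch h0 _ hc _]]; apply: le_trans (hc 0%N).
by rewrite -Lam0; apply: Lam_le.
Qed.

Let mu_cover A c : function_cover A c -> (mu A <= c%:E)%E.
Proof. by move=> Ac; apply: ereal_inf_lbound; exists c. Qed.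

Let mu_ge0 A : (0 <= mu A)%E.
Proof.
by apply: le_ereal_inf_tmp => _ [c Ac <-]; rewrite lee_fin; exact: cover_ge0 Ac.
Qed.

Let mu_le1 A : (mu A <= 1)%E.
Proof.
apply: mu_cover; exists (fun _ _ => 1); split => //.
- by move=> j; rewrite Lam1.
- by move=> x _ _; exists 0%N.
Qed.

Let mu_fin A : mu A \is a fin_num.
Proof.
rewrite ge0_fin_numE//; apply: le_lt_trans (mu_le1 A) _.
by rewrite ltry.
Qed.

Let mu0 : mu set0 = 0%E.
Proof.
apply/eqP; rewrite eq_le mu_ge0 andbT; apply: mu_cover.
exists (fun _ _ => 0); split => //.
by move=> j; rewrite Lam0.
Qed.

Let mu_mono : {homo mu : A B / A `<=` B >-> (A <= B)%E}.
Proof.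
move=> A B AB; apply: le_ereal_inf_tmp => _ [c [h [ch h0 hS hc hB]] <-].
by apply: mu_cover; exists h; split => // x /AB; exact: hB.
Qed.

Let mu_adherent A e : 0 < e -> exists2 c, function_cover A c & (c%:E <= mu A + e%:E)%E.
Proof.
move=> e0; have [_ [c Ac <-] ce] := lb_ereal_inf_adherent e0 (mu_fin A).
by exists c => //; exact: ltW.
Qed.

Let seq_mono (f : nat -> R) : (forall j, f j <= f j.+1) ->
  forall i j, (i <= j)%N -> f i <= f j.
Proof. by move=> /nondecreasing_seqP h i j; exact: h. Qed.

Let mu_sigma : sigma_subadditive mu.
Proof.
move=> F; apply/lee_addgt0Pr => e e0.
have ei i : 0 < e / (2 ^ i.+1)%:R.
  by rewrite divr_gt0// ltr0n expn_gt0.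
have /choice[c hc] : forall i, exists c, function_cover (F i) c /\
    (c%:E <= mu (F i) + (e / (2 ^ i.+1)%:R)%:E)%E.
  by move=> i; have [c ? ?] := mu_adherent (F i) (ei i); exists c.
have /choice[h hh] : forall i, exists h : nat -> T -> R,
    [/\ forall j, continuous (h j), forall j x, 0 <= h j x,
        forall j x, h j x <= h j.+1 x, forall j, Lam (h j) <= c i
      & forall x, F i x -> X x -> exists j, 1 <= h j x].
  by move=> i; exact: (hc i).1.
apply: le_trans (epsilon_trick xpredT (fun n => mu_ge0 (F n)) (ltW e0)).
set S := (X in (_ <= X)%E).
have Sge n : ((\sum_(0 <= i < n) c i)%:E <= S)%E.
  rewrite -sumEFin; apply: (@le_trans _ _ (\sum_(0 <= i < n)
      (mu (F i) + (e / (2 ^ i.+1)%:R)%:E))%E).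
    by apply: lee_sum => i _; exact: (hc i).2.
  apply: nneseries_lim_ge => i _ _; apply: adde_ge0 => //.
  by rewrite lee_fin ltW.
have [Sfin|Sninf] := boolP (S \is a fin_num); last first.
  have S0 : (0 <= S)%E by have := Sge 0%N; rewrite big_geq.
  by move: Sninf; rewrite ge0_fin_numE// -leNgt leye_eq => /eqP ->; rewrite leey.
rewrite -(fineK Sfin); apply: mu_cover.
(* A diagonal choice: the [j]-th function is a finite sum of the [j]-th functions of the first [j]
   covers, so finite additivity of [Lam] suffices and the sequence still increases. *)
exists (fun j x => \sum_(0 <= i < j) h i j x); split.
- move=> j; have := @Lam_sum (fun i => h i j) j.
  by case=> [i|//]; case: (hh i).
- by move=> j x; apply: sumr_ge0 => i _; case: (hh i).
- move=> j x; rewrite big_nat_recr//= -[leLHS]addr0 lerD//; last by case: (hh j).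
  by apply: ler_sum => i _; case: (hh i).
- move=> j; have [_ ->] := @Lam_sum (fun i => h i j) j (fun i => let: And5 hci _ _ _ _ := hh i in hci j).
  rewrite -lee_fin fineK//; apply: le_trans (Sge j).
  by rewrite lee_fin; apply: ler_sum => i _; case: (hh i).
- move=> x [i _ Fix] Xx.
  have [_ h0 hS _ /(_ _ Fix Xx)[j hj]] := hh i.
  (* Past [i.+1] the [i]-th cover takes part in the sum, and past [j] its function is at least 1 at
     [x]. *)
  pose J := maxn j i.+1; exists J.
  have iJ : (i < J)%N by rewrite leq_maxr.
  rewrite (big_cat_nat (n := i.+1))//= big_nat_recr//=.
  have hJ : 1 <= h i J x.
    apply: le_trans hj _; apply: (@seq_mono (fun j => h i j x)) => //.
    exact: leq_maxl.
  apply: le_trans hJ _.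
  rewrite -addrA addrCA lerDl addr_ge0//; apply: sumr_ge0 => k _; by case: (hh k).
Qed.

HB.instance Definition _ := isOuterMeasure.Build R T mu mu0 mu_ge0 mu_mono mu_sigma.

(* If [h] covers [A] and [g] increases to the indicator of [O], then
   [h j * g j] covers [A `&` O], while [h j * (1 - g J)] covers [A `\` O]. *)
Lemma open_caratheodory (O : set T) : open O -> mu.-caratheodory O.
Proof.
move=> oO; apply: le_caratheodory_measurable => A.
have [g [cg g01 gS g0 g1]] := exhaustion oO.
apply/lee_addgt0Pr => e e0.
have e20 : 0 < e / 2 by rewrite divr_gt0.
have [c [h [ch h0 hS hc hA]] cA] := mu_adherent A e20.
have gge0 j x : 0 <= g j x by have /andP[] := g01 j x.
have gle1 j x : g j x <= 1 by have /andP[] := g01 j x.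
pose a j := Lam (fun x => h j x * g j x).
have a_le_c j : a j <= c.
  apply: le_trans (hc j); apply: Lam_le => //; first exact: continuous_mul.
  by move=> x _; rewrite -[leRHS]mulr1 ler_wpM2l.
have hsa : has_sup (range a).
  by split; [exists (a 0%N), 0%N|exists c => _ [j _ <-]].
pose s := sup (range a).
have a_le_s j : a j <= s by apply: ub_le_sup; [exact: hsa.2|exists j].
have [_ [J _ <-] aJ] := sup_adherent e20 hsa.
have cov1 : function_cover (A `&` O) s.
  exists (fun j x => h j x * g j x); split => //.
  - by move=> j; exact: continuous_mul.
  - by move=> j x; exact: mulr_ge0.
  - by move=> j x; exact: ler_pM.
  - move=> x [Ax Ox] Xx; have [j hj] := hA _ Ax Xx; have [i gi] := g1 _ Ox.
    exists (maxn i j).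
    have -> : g (maxn i j) x = 1.
      apply/eqP; rewrite eq_le gle1/= -gi.
      by apply: (@seq_mono (fun j => g j x)) => //; exact: leq_maxl.
    rewrite mulr1; apply: le_trans hj _.
    by apply: (@seq_mono (fun j => h j x)) => //; exact: leq_maxr.
have cov2 : function_cover (A `&` ~` O) (c - (s - e / 2)).
  exists (fun j x => h j x * (1 - g J x)).
  have cf j : continuous (fun x => h j x * (1 - g J x)).
    by apply: continuous_mul => //; exact: continuous_sub.
  have fS j x : h j x * (1 - g J x) <= h j.+1 x * (1 - g J x).
    by apply: ler_wpM2r => //; rewrite subr_ge0.
  split => //.
  - by move=> j x; rewrite mulr_ge0// subr_ge0.
  (* Raising the index to [maxn j J] only enlarges the function, and makes [h * g J] dominate
     [h J * g J], on which [Lam] exceeds [s - e / 2]. *)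
  - move=> j; apply: (@le_trans _ _ (Lam (fun x => h (maxn j J) x * (1 - g J x)))).
      apply: Lam_le => // x _.
      by apply: (@seq_mono (fun j => h j x * (1 - g J x))) => //; exact: leq_maxl.
    have -> : (fun x => h (maxn j J) x * (1 - g J x)) =
        (fun x => h (maxn j J) x - h (maxn j J) x * g J x).
      by apply/funext => x; ring.
    rewrite LamB//; last exact: continuous_mul.
    apply: lerB; first exact: hc.
    apply: le_trans (ltW aJ) _; apply: Lam_le; [exact: continuous_mul..|].
    move=> x _; apply: ler_wpM2r => //.
    by apply: (@seq_mono (fun j => h j x)) => //; exact: leq_maxr.
  - move=> x [Ax nOx] Xx; have [j hj] := hA _ Ax Xx.
    by exists j; rewrite g0// subr0 mulr1.
apply: (@le_trans _ _ (s%:E + (c - (s - e / 2))%:E)%E).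
  by apply: leeD; exact: mu_cover.
apply: (@le_trans _ _ (c%:E + (e / 2)%:E)%E).
  by rewrite -!EFinD lee_fin; lra.
apply: le_trans (leeD2r _ cA) _.
by rewrite -addeA -EFinD -splitr.
Qed.

Lemma borel_caratheodory (A : set (borel T)) : measurable A -> mu.-caratheodory A.
Proof.
apply: smallest_sub; last by move=> O /=; exact: open_caratheodory.
have [m0 mC mU] := @sigma_algebra_measurable _ (caratheodory_type mu).
by split => //.
Qed.

Definition functional_measure (A : set (borel T)) : \bar R := mu A.
Local Notation nu := functional_measure.

Let nu0 : nu set0 = 0%E. Proof. exact: mu0. Qed.
Let nu_ge0 A : (0 <= nu A)%E. Proof. exact: mu_ge0. Qed.
Let nu_sigma : semi_sigma_additive nu.
Proof.
move=> F mF tF mU.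
apply: (@caratheodory_measure_sigma_additive _ _ mu F) => //.
- by move=> i; exact: borel_caratheodory.
- exact: borel_caratheodory.
Qed.

HB.instance Definition _ := isMeasure.Build _ _ _ nu nu0 nu_ge0 nu_sigma.

(** Dini's argument: an increasing sequence that reaches 1 at each point of the compact [X] has a
    single member above [1 - e] on all of [X], and [Lam] is monotone relative to [X]. *)
Let nuT : nu setT = 1%E.
Proof.
apply/eqP; rewrite eq_le mu_le1/=.
apply: le_ereal_inf_tmp => _ [c [h [ch h0 hS hc hX]] <-].
rewrite lee_fin; apply/ler_addgt0Pl => e e0.
have : \forall j \near \oo, X `<=` [set x | 1 - e <= h j x].
  apply: (proj1 (compact_near_coveringP X) X_compact) => x Xx.
  have [j0 hj0] := hX x I Xx.
  have : \forall x' \near x, 1 - e < h j0 x'.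
    by have /cvgr_gt := ch j0 x; apply; lra.
  move=> nx; near=> x' j => /=.
  have : h j0 x' <= h j x'.
    apply: (@seq_mono (fun j => h j x')) => //; near: j; exact: nbhs_infty_ge.
  have : 1 - e < h j0 x' by near: x'.
  lra.
move=> [N _ /(_ N (leqnn N)) hN].
apply: (@le_trans _ _ (e + Lam (h N))); last by rewrite lerD2l.
rewrite -lerBlDl.
rewrite -[X in X <= _]Lam_cst; apply: Lam_le => // x; exact: hN.
Unshelve. all: by end_near. Qed.

HB.instance Definition _ := Measure_isProbability.Build _ _ _ nu nuT.


Let nu_compl : nu (~` X) = 0%E.
Proof.
apply/eqP; rewrite eq_le nu_ge0 andbT; apply: mu_cover.
exists (fun _ _ => 0); split => //.
by move=> j; rewrite Lam0.
Qed.

Let nu_markov (k : T -> R) (A : set (borel T)) : continuous k ->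
  (forall x, 0 <= k x) -> (forall x, A x -> 1 <= k x) -> (nu A <= (Lam k)%:E)%E.
Proof.
move=> ck k0 kA; apply: mu_cover; exists (fun=> k); split => //.
by move=> x /kA kx _; exists 0%N.
Qed.

(** Cut [f] into slices [k i] of height 1. The indicator of [f >= i + 1] lies below [k i], so its
    measure is at most [Lam (k i)], while [f] is at most 1 plus the sum of these indicators. The
    loss of 1 is removed afterwards by scaling. *)
Let integral_le1D (f : T -> R) (N : nat) : continuous f ->
  (forall x, 0 <= f x <= N%:R) -> (\int[nu]_x (f x)%:E <= (1 + Lam f)%:E)%E.
Proof.
move=> cf f0N.
pose A i : set (borel T) := [set x | i.+1%:R <= f x].
have mA i : measurable (A i).
  have -> : A i = setT `&` (f : borel T -> R) @^-1` [set` `[i.+1%:R, +oo[].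
    by apply/seteqP; split => x /=; rewrite in_itv/= andbT => // -[].
  exact: (continuous_borel_measurable cf measurableT (measurable_itv _)).
pose k i x := Num.min (Num.max (f x - i%:R) 0) 1.
have ck i : continuous (k i).
  move=> x; apply: (@continuous_min _ _ (fun x => Num.max (f x - i%:R) 0) (fun=> 1)); last exact: cst_cont.
  apply: (@continuous_max _ _ (fun x => f x - i%:R) (fun=> 0)); last exact: cst_cont.
  by move: x; apply: continuous_sub.
have sumk x n : \sum_(0 <= i < n) k i x = Num.min (f x) n%:R.
  have /andP[fx0 _] := f0N x.
  elim: n => [|n IHn]; first by rewrite big_geq//; apply/esym/min_idPr.
  rewrite big_nat_recr//= IHn /k -natr1.
  case: (leP (f x) n%:R) => ?; case: (leP (f x - n%:R) 0) => ?;
    case: (leP (f x) (n%:R + 1)) => ?; case: leP => ?; lra.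
have f_le x n : Num.min (f x) n.+1%:R <= 1 + \sum_(0 <= i < n) \1_(A i) x.
  elim: n => [|n IHn]; first by rewrite big_geq// addr0 ge_min lexx orbT.
  rewrite big_nat_recr//= addrA indicE.
  have [Ax|nAx] := pselect (A n x).
    rewrite mem_set//=; apply: le_trans (lerD IHn (lexx 1)).
    rewrite -[n.+2%:R]natr1; move: Ax; rewrite /A/= => Ax.
    rewrite [Num.min _ n.+1%:R](min_idPr _)//.
    by rewrite ge_min lexx orbT.
  rewrite memNset//= addr0; apply: le_trans IHn.
  move/negP: nAx; rewrite -ltNge => /ltW fx.
  rewrite (min_idPl fx) (min_idPl _)//.
  by apply: (le_trans fx); rewrite ler_nat.
have mI i : measurable_fun [set: borel T] (fun x : borel T => (\1_(A i) x)%:E : \bar R).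
  by apply/measurable_EFinP; exact: measurable_indic.
have I0 i (x : borel T) : [set: borel T] x -> (0 <= (\1_(A i) x)%:E :> \bar R)%E.
  by move=> _; rewrite lee_fin indicE.
have mS : measurable_fun [set: borel T]
    (fun x : borel T => \sum_(i <- index_iota 0 N) (\1_(A i) x)%:E : \bar R)%E.
  exact: emeasurable_sum.
apply: (@le_trans _ _ (\int[nu]_x ((cst 1%:E x) + \sum_(i <- index_iota 0 N) (\1_(A i) x)%:E))%E).
  apply: ge0_le_integral => //.
  - by move=> x _; rewrite lee_fin; have /andP[] := f0N x.
  - by apply/measurable_EFinP; exact: continuous_borel_measurable.
  - by apply: emeasurable_funD => //; exact: measurable_cst.
  - move=> x _; rewrite sumEFin -EFinD lee_fin; apply: le_trans (f_le x N).
    rewrite le_min lexx/=; have /andP[_ /le_trans] := f0N x; apply.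
    by rewrite ler_nat.
rewrite (ge0_integralD _ measurableT _ (measurable_cst _) _ mS)//; last first.
  by move=> x _; apply: sume_ge0 => i _; exact: I0.
rewrite integral_cst// mul1e -[X in (X + _ <= _)%E]/(nu setT) nuT.
rewrite (ge0_integral_sum _ measurableT mI I0).
rewrite EFinD; apply: leeD2l.
have [_ Lk] := Lam_sum N ck.
have -> : Lam f = \sum_(0 <= i < N) Lam (k i).
  rewrite -Lk; congr Lam; apply/funext => x; rewrite sumk; apply/esym/min_idPl.
  by have /andP[] := f0N x.
rewrite -sumEFin; apply: lee_sum => i _.
rewrite integral_indic// setIT; apply: nu_markov => //.
- by move=> x; rewrite /k le_min ler01 le_max lexx orbT.
- move=> x; rewrite /A/= => h; rewrite /k le_min lexx andbT le_max.
  by rewrite lerBrDr -natr1 addrC in h *; rewrite h.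
Qed.

(** Applying the crude bound to [m * f] and dividing by [m] sends the additive error 1 to zero. *)
Let integral_le (f : T -> R) (c : R) : continuous f ->
  (forall x, 0 <= f x <= c) -> (\int[nu]_x (f x)%:E <= (Lam f)%:E)%E.
Proof.
move=> cf f0c.
have fge0 x : 0 <= f x by have /andP[] := f0c x.
have intf : nu.-integrable setT (fun x => (f x)%:E).
  apply: (@bounded_continuous_integrable _ _ nu f c) => // x.
  by rewrite ger0_norm//; have /andP[] := f0c x.
have Ifin := integrable_fin_num measurableT intf.
rewrite -(fineK Ifin) lee_fin; set I := fine _.
suff h (m : nat) : m%:R * I <= 1 + m%:R * Lam f.
  rewrite leNgt; apply/negP => LI.
  have d0 : 0 < I - Lam f by rewrite subr_gt0.
  have := h (Num.truncn (I - Lam f)^-1).+1; rewrite -lerBlDr -mulrBr.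
  by rewrite leNgt -ltr_pdivrMr// div1r truncnS_gt.
have cm : continuous (fun x => m%:R * f x) by exact: continuous_mul.
have := @integral_le1D (fun x => m%:R * f x) (Num.truncn (m%:R * c)).+1 cm.
rewrite LamZ// => hm; rewrite -lee_fin EFinM fineK//.
rewrite -integralZl//; apply: hm => x.
rewrite mulr_ge0//=; apply: ltW; apply: le_lt_trans (truncnS_gt _).
by rewrite ler_wpM2l//; have /andP[] := f0c x.
Qed.

(** The reverse inequality is the previous one for [c - f]. *)
Let integral_bounded (f : T -> R) (c : R) : continuous f ->
  (forall x, 0 <= f x <= c) -> (\int[nu]_x (f x)%:E = (Lam f)%:E)%E.
Proof.
move=> cf f0c; apply/eqP; rewrite eq_le (integral_le cf f0c)/=.
have intf : nu.-integrable setT (fun x => (f x)%:E).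
  apply: (@bounded_continuous_integrable _ _ nu f c) => // x.
  by rewrite ger0_norm; have /andP[] := f0c x.
have intc : nu.-integrable setT (fun=> c%:E).
  exact: (@bounded_continuous_integrable _ _ nu (fun=> c) `|c|).
have cg : continuous (fun x => c - f x) by exact: continuous_sub.
have := @integral_le (fun x => c - f x) c cg.
have -> : Lam (fun x => c - f x) = c - Lam f.
  by rewrite LamB// Lam_cst.
have -> : (\int[nu]_x (c - f x)%:E = c%:E - \int[nu]_x (f x)%:E)%E.
  under eq_integral do rewrite EFinB.
  by rewrite integralB// integral_cst// (nuT : Measure.sort nu setT = 1%E) mule1.
rewrite -(fineK (integrable_fin_num measurableT intf)) -EFinB !lee_fin => h.
have /h : forall x, 0 <= c - f x <= c.
  by move=> x; have /andP[] := f0c x; lra.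
lra.
Qed.

(** Truncating [f] at a bound for its absolute value on [X] changes neither [Lam f] nor, since the
    complement of [X] is null, the integral. The shift by [c] makes the truncation nonnegative. *)
Lemma riesz_integral (f : T -> R) : continuous f ->
  nu.-integrable setT (fun x => (f x)%:E) /\
  (\int[nu]_x (f x)%:E = (Lam f)%:E)%E.
Proof.
move=> cf.
have [c c0 fc] := compact_bounded_above X_compact cf.
pose g x := Num.max (Num.min (f x) c) (- c) + c.
have cg : continuous g.
  apply: continuous_add => // x.
  apply: (@continuous_max _ _ (fun x => Num.min (f x) c) (fun=> - c)); last exact: cst_cont.
  by apply: (@continuous_min _ _ f (fun=> c)); [exact: cf|exact: cst_cont].
have g0 x : 0 <= g x <= c + c.
  rewrite /g; case: (leP (f x) c) => ?;
    [case: (leP (f x) (- c)) => ?|case: (leP c (- c)) => ?]; apply/andP; lra.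
have gE x : X x -> g x = f x + c.
  move=> /fc; rewrite ler_norml => /andP[h1 h2].
  by rewrite /g (min_idPl h2) (max_idPl h1).
have mf : measurable_fun [set: borel T] (f : borel T -> R).
  exact: continuous_borel_measurable.
have mg : measurable_fun [set: borel T] (fun x : borel T => g x - c).
  by apply: continuous_borel_measurable; exact: continuous_sub.
have fg : ae_eq nu setT (fun x => (f x)%:E) (fun x => (g x - c)%:E).
  exists [set x | f x != g x - c]; split.
  - have -> : [set x | f x != g x - c] =
        setT `&` (fun x : borel T => f x - (g x - c)) @^-1` (~` [set 0]).
      apply/seteqP; split => x /=; first by move=> /eqP h; split => // /subr0_eq.
      by move=> [_ h]; apply/eqP => h'; apply: h; rewrite h' subrr.
    by apply: measurable_funB => //; exact: measurableC.
  - apply/eqP; rewrite eq_le measure_ge0 andbT -nu_compl.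
    apply: mu_mono => x /= /eqP h Xx; apply: h; rewrite gE//; lra.
  - by move=> x /= h; apply/eqP => h'; apply: h => _; rewrite -h'.
have intg : nu.-integrable setT (fun x => (g x - c)%:E).
  apply: (@bounded_continuous_integrable _ _ nu (fun x => g x - c) c).
    exact: continuous_sub.
  by move=> x; have := g0 x; rewrite ler_norml; lra.
split.
  apply/integrableP; split; first exact/measurable_EFinP.
  have /integrableP[_] := intg; apply: le_lt_trans; rewrite le_eqVlt.
  apply/orP; left; apply/eqP.
  apply: ae_eq_integral => //.
  - by apply: measurableT_comp => //; exact/measurable_EFinP.
  - by apply: measurableT_comp => //; exact/measurable_EFinP.
  - exact: ae_eq_abse.
rewrite (ae_eq_integral (fun x : borel T => (g x - c)%:E))//; try exact/measurable_EFinP.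
have intg' : nu.-integrable setT (fun x => (g x)%:E).
  apply: (@bounded_continuous_integrable _ _ nu g (c + c)) => //.
  by move=> x; have := g0 x; rewrite ler_norml; lra.
have intc : nu.-integrable setT (fun=> c%:E).
  exact: (@bounded_continuous_integrable _ _ nu (fun=> c) `|c|).
under eq_integral do rewrite EFinB.
rewrite integralB// (integral_bounded cg g0) integral_cst// (nuT : Measure.sort nu setT = 1%E) mule1 -EFinB.
congr EFin.
rewrite -[X in _ - X]Lam_cst.
rewrite -LamB//; apply/eqP; rewrite eq_le; apply/andP; split.
  by apply: Lam_le => //; [exact: continuous_sub|move=> x Xx; rewrite gE//; lra].
by apply: Lam_le => //; [exact: continuous_sub|move=> x Xx; rewrite gE//; lra].
Qed.

Theorem riesz_representation : exists P : probability (borel T) R,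
  forall f : T -> R, continuous f ->
    P.-integrable setT (fun x => (f x)%:E) /\
    (\int[P]_x (f x)%:E = (Lam f)%:E)%E.
Proof. by exists nu => f; exact: riesz_integral. Qed.

End Riesz.

(** * Averages of continuous functions *)

Section Mean.
Context {R : realType}.
Implicit Types f g : R -> R.

(* The lower limit [-1] leaves room to differentiate at every point of [[0, 1]]. *)
Lemma primitive_exists f : continuous f ->
  exists G : R -> R, forall x : R, -1 < x -> is_derive x 1 G (f x).
Proof.
move=> cf.
exists (fun x => \int[lebesgue_measure]_(t in [set` `[-1, x]]) f t)%R => x x1.
have xx1 : x < x + 1 by rewrite ltrDl.
have := @continuous_FTC1_closed R f (-1) x (x + 1) xx1 _ x1 (cf x).
case=> [|d <-]; last by rewrite derive1E; exact/derivableP.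
by apply: continuous_compact_integrable; [exact: segment_compact|exact: continuous_subspaceT].
Qed.

Definition primitive f : R -> R :=
  xget (fun=> 0) [set G | forall x : R, -1 < x -> is_derive x 1 G (f x)].

(** This is the integral of [f] over [[0, 1]]. Written as an increment of an antiderivative, it is
    estimated by the mean value theorem alone. *)
Definition mean f : R := primitive f 1 - primitive f 0.

Lemma primitiveP f : continuous f -> forall x : R, -1 < x -> is_derive x 1 (primitive f) (f x).
Proof.
move=> cf; have [G GP] := primitive_exists cf.
by rewrite /primitive; case: xgetP => [? _ //|/(_ G)].
Qed.

Lemma MVT_gtN1 (G g : R -> R) a b : (forall x : R, -1 < x -> is_derive x 1 G (g x)) ->
  -1 < a -> a <= b -> exists2 c, a <= c <= b & G b - G a = g c * (b - a).
Proof.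
move=> Gg a1 ab.
have [||c] := @MVT_segment R G g a b ab.
- by move=> x; rewrite in_itv/= => /andP[ax _]; apply: Gg; exact: lt_trans ax.
- apply: derivable_within_continuous => x; rewrite in_itv/= => /andP[ax _].
  by have [] := Gg x (lt_le_trans a1 ax).
by rewrite in_itv/= => cab E; exists c.
Qed.

(** Antiderivatives are chosen arbitrarily, so linearity is not built in: the difference of the two
    candidates has zero derivative, hence equal values at 0 and 1. *)
Lemma mean_linear a f g : continuous f -> continuous g ->
  mean (fun x => a * f x + g x) = a * mean f + mean g.
Proof.
move=> cf cg.
have ch : continuous (fun x => a * f x + g x).
  move=> x; apply: cvgD; last exact: cg.
  by apply: cvgM; [exact: cvg_cst|exact: cf].
pose D := fun x => primitive (fun x => a * f x + g x) x - (a * primitive f x + primitive g x).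
have dD (x : R) : -1 < x -> is_derive x 1 D 0.
  move=> x1; have h := primitiveP ch x1.
  have hf := primitiveP cf x1; have hg := primitiveP cg x1.
  rewrite /D; apply: is_derive_eq; rewrite /GRing.scale/=; ring.
have [c _] := MVT_gtN1 dD (ltrN10 R) ler01.
rewrite mul0r /D /mean; lra.
Qed.

Lemma mean_bounds f m M : continuous f -> (forall x, 0 <= x <= 1 -> m <= f x <= M) ->
  m <= mean f <= M.
Proof.
move=> cf fb; have [c c01] := MVT_gtN1 (primitiveP cf) (ltrN10 R) ler01.
by rewrite /mean => ->; rewrite subr0 mulr1; exact: fb.
Qed.

(** Shifting the interval changes the integral only near its two ends, by two increments of the
    antiderivative of length [t]; the mean value theorem evaluates each. The bound on [t] keeps all
    points to the right of -1. *)
Lemma mean_shift f t : continuous f -> `|t| < 1 ->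
  exists a b, [/\ `|a| <= `|t|, `|b| <= `|t| &
    mean (fun x => f (x + t)) - mean f = t * (f (1 + a) - f b)].
Proof.
move=> cf t1.
have [t1' t1''] : -1 < t /\ t < 1 by move: t1; rewrite ltr_norml => /andP.
have cft : continuous (fun x => f (x + t)).
  move=> x; apply: (@continuous_comp _ _ _ (fun x => x + t) f); last exact: cf.
  by apply: cvgD; [exact: cvg_id|exact: cvg_cst].
pose G := primitive f.
have dG (x : R) : -1 < x -> is_derive x 1 G (f x) by exact: primitiveP.
pose D := fun x => primitive (fun x => f (x + t)) x - G (x + t).
have dD (x : R) : 0 <= x -> is_derive x 1 D 0.
  move=> x0; have x1 : -1 < x by exact: lt_le_trans x0.
  have h := primitiveP cft x1.
  have xt : -1 < x + t by apply: lt_le_trans t1' _; rewrite lerDr.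
  have hG := dG _ xt.
  have hs : is_derive x 1 (fun x => x + t) 1.
    by apply: is_derive_eq; rewrite addr0.
  have hGc : is_derive x 1 (fun x => G (x + t)) (f (x + t)).
    have : is_derive x 1 (G \o (fun x => x + t)) (f (x + t) * 1).
      exact: is_derive1_comp.
    by rewrite mulr1.
  by rewrite /D; apply: is_derive_eq; rewrite subrr.
have D01 : D 1 = D 0.
  have [||c _] := @MVT_segment R D (fun=> 0) 0 1 ler01.
  - by move=> x; rewrite in_itv/= => /andP[x0 _]; apply: dD; exact: ltW.
  - apply: derivable_within_continuous => x; rewrite in_itv/= => /andP[x0 _].
    by have [] := dD x x0.
  by rewrite mul0r => /subr0_eq.
have E : mean (fun x => f (x + t)) - mean f = (G (1 + t) - G 1) - (G (0 + t) - G 0).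
  by move: D01; rewrite /D /mean -/G; lra.
have step (x : R) : 0 <= x -> exists2 a, `|a| <= `|t| & G (x + t) - G x = t * f (x + a).
  move=> x0.
  have xt : -1 < x + t by apply: lt_le_trans t1' _; rewrite lerDr.
  have x1 : -1 < x by exact: lt_le_trans x0.
  have [t0|t0] := leP 0 t.
    have [|c /andP[c1 c2] Ec] := MVT_gtN1 dG x1 (_ : x <= x + t); first by rewrite lerDl.
    exists (c - x); last by rewrite Ec [x + (c - x)]addrC subrK; ring.
    by rewrite !ger0_norm ?subr_ge0//; lra.
  have [|c /andP[c1 c2] Ec] := MVT_gtN1 dG xt (_ : x + t <= x); first by rewrite gerDl ltW.
  exists (c - x); last by rewrite -opprB Ec [x + (c - x)]addrC subrK; ring.
  rewrite !ler0_norm ?subr_le0//; [lra|exact: ltW].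
have [a at_ Ea] := step 1 ler01; have [b bt Eb] := step 0 (lexx _).
by exists a, b; split => //; rewrite E Ea Eb add0r; ring.
Qed.

End Mean.

(** * Differentiation along the flow *)

Section Rows.
Context {R : realType} {n : nat}.
Local Notation V := 'rV[R]_n.

Lemma row_coord_le (v : V) (i : 'I_n) : `|v ord0 i| <= `|v|.
Proof.
rewrite -[leRHS]/(mx_norm v) mx_normrE.
by apply: (le_bigmax _ (fun ij => `|v ij.1 ij.2|) (ord0, i)).
Qed.

Lemma row_norm_le (v : V) (c : R) : 0 <= c -> (forall i, `|v ord0 i| <= c) -> `|v| <= c.
Proof.
move=> c0 vc; rewrite -[leLHS]/(mx_norm v) mx_normrE.
by apply: bigmax_le => // -[i j] _ /=; rewrite ord1.
Qed.

Lemma continuous_sum (T : topologicalType) (I : Type) (s : seq I) (f : I -> T -> R) :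
  (forall i, continuous (f i)) -> continuous (fun x => \sum_(i <- s) f i x).
Proof.
move=> cf; elim: s => [|i s IHs] x.
  under eq_fun do rewrite big_nil; exact: cvg_cst.
by under eq_fun do rewrite big_cons; apply: cvgD; [exact: cf|exact: IHs].
Qed.

Lemma continuous_row (T : topologicalType) (f : T -> V) :
  (forall i, continuous (fun x => f x ord0 i)) -> continuous f.
Proof.
move=> cf x; apply/cvgrPdist_lt => e e0.
have e20 : 0 < e / 2 by rewrite divr_gt0.
near=> y; apply: (@le_lt_trans _ _ (e / 2)); last by rewrite ltr_pdivrMr// ltr_pMr// ltr1n.
apply: row_norm_le; first exact: ltW.
suff : forall i : 'I_n, true -> `|f x ord0 i - f y ord0 i| <= e / 2.
  by move=> h i; rewrite !mxE; exact: h.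
near: y; apply: filter_forall => i.
have /cvgrPdist_lt/(_ _ e20) := cf i x.
by apply: filterS => y /ltW + _.
Unshelve. all: by end_near. Qed.

Definition dotr (w v : V) : R^o := dotv v w.

Let dotr_linear w : linear (dotr w).
Proof.
move=> a u v; rewrite /dotr /dotv scaler_sumr -big_split/=; apply: eq_bigr => i _.
by rewrite !mxE mulrDl -mulrA.
Qed.

HB.instance Definition _ w := GRing.isLinear.Build R V R^o _ (dotr w) (dotr_linear w).

Lemma dotvDl (u v w : V) : dotv (u + v) w = dotv u w + dotv v w.
Proof. exact: (raddfD (dotr w)). Qed.

Lemma dotvZl (a : R) (v w : V) : dotv (a *: v) w = a * dotv v w.
Proof. by rewrite -[LHS]/(dotr w (a *: v)) linearZ. Qed.

Lemma dotvC (v w : V) : dotv v w = dotv w v.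
Proof. by apply: eq_bigr => i _; rewrite mulrC. Qed.

Lemma dotv_delta (i : 'I_n) (w : V) : dotv (delta_mx ord0 i) w = w ord0 i.
Proof.
rewrite /dotv (bigD1 i)//= mxE !eqxx mul1r big1 ?addr0// => j ji.
by rewrite mxE eqxx/= (negbTE ji) mul0r.
Qed.

Lemma dotv_le (v w : V) (c : R) : (forall i, `|w ord0 i| <= c) -> `|dotv v w| <= n%:R * c * `|v|.
Proof.
move=> wc; apply: le_trans (ler_norm_sum _ _ _) _.
apply: (@le_trans _ _ (\sum_(i < n) c * `|v|)).
  apply: ler_sum => i _; rewrite normrM mulrC; apply: ler_pM => //.
  exact: row_coord_le.
by rewrite sumr_const card_ord -mulrA mulr_natl.
Qed.

Lemma continuous_dotv (T : topologicalType) (f g : T -> V) :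
  continuous f -> continuous g -> continuous (fun x => dotv (f x) (g x)).
Proof.
move=> cf cg; apply: continuous_sum => i x; apply: cvgM.
- apply: (@continuous_comp _ _ _ f (fun M : V => M ord0 i)); first exact: cf.
  exact: coord_continuous.
- apply: (@continuous_comp _ _ _ g (fun M : V => M ord0 i)); first exact: cg.
  exact: coord_continuous.
Qed.

Lemma row_norm_le_enorm (v : V) : `|v| <= enorm v.
Proof.
apply: row_norm_le; first exact: sqrtr_ge0.
move=> i; rewrite -sqrtr_sqr; apply: ler_wsqrtr.
rewrite /dotv (bigD1 i)//= -expr2 lerDl; apply: sumr_ge0 => j _.
by rewrite -expr2 sqr_ge0.
Qed.

Lemma enorm_le (v : V) : enorm v <= n%:R * `|v|.
Proof.
rewrite -[leRHS]ger0_norm ?mulr_ge0// -sqrtr_sqr; apply: ler_wsqrtr.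
apply: (@le_trans _ _ (\sum_(i < n) `|v| ^+ 2)).
  apply: ler_sum => i _; rewrite -expr2 -[leLHS]ger0_norm ?sqr_ge0// normrX.
  by rewrite ler_sqr ?nnegrE//; exact: row_coord_le.
rewrite sumr_const card_ord exprMn -[leLHS]mulr_natl ler_wpM2r ?sqr_ge0//.
by rewrite -natrX ler_nat -mulnn; case: (n) => // m; rewrite leq_pmull.
Qed.

End Rows.

(** * Means along orbit segments and their derivatives along the flow *)

Section Flow.
Context {R : realType} {n : nat} {Omega : pmetricType R}.
Local Notation V := 'rV[R]_n.
Variable tau : V -> Omega -> Omega.
Hypothesis Omega_compact : compact [set: Omega].
Hypothesis tau_action : continuous_action tau.

Let tauC : continuous (fun p : V * Omega => tau p.1 p.2).
Proof. by case: tau_action. Qed.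
Let tauD x y w : tau (x + y) w = tau x (tau y w).
Proof. by case: tau_action. Qed.
Let tau0 w : tau 0 w = w.
Proof. by case: tau_action. Qed.

Lemma continuous_flow (f : Omega -> R) : continuous f ->
  continuous (fun p : V * Omega => f (tau p.1 p.2)).
Proof. exact: continuous_compose. Qed.

Lemma continuous_flow_at x : continuous (tau x).
Proof.
apply: (@continuous_compose _ _ _ (fun w => (x, w)) (fun p : V * Omega => tau p.1 p.2)) => //.
by apply: continuous_pair => w; [exact: cvg_cst|exact: cvg_id].
Qed.

Lemma flow_uniform (f : Omega -> R) (e : R) : continuous f -> 0 < e ->
  \forall y \near (0 : V), forall w, `|f (tau y w) - f w| < e.
Proof.
move=> cf e0.
have := compact_tube (0 : V) Omega_compact (continuous_flow cf) e0.
by apply: filterS => y /= h w; have := h w I; rewrite tau0.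
Qed.

Lemma continuous_ray (f : Omega -> R) (d : V) : continuous f ->
  continuous (fun p : Omega * R => f (tau (p.2 *: d) p.1)).
Proof.
move=> cf; apply: (@continuous_compose _ _ _ (fun p : Omega * R => (p.2 *: d, p.1))
  (fun p : V * Omega => f (tau p.1 p.2))); last exact: continuous_flow.
apply: continuous_pair => p; last exact: cvg_fst.
by apply: cvgZr_tmp; exact: cvg_snd.
Qed.

Lemma continuous_ray_at (f : Omega -> R) (d : V) w : continuous f ->
  continuous (fun s : R => f (tau (s *: d) w)).
Proof.
move=> cf; apply: (@continuous_compose _ _ _ (fun s : R => (w, s))
  (fun p : Omega * R => f (tau (p.2 *: d) p.1))); last exact: continuous_ray.
by apply: continuous_pair => s; [exact: cvg_cst|exact: cvg_id].
Qed.

Definition mean_along (d : V) (f : Omega -> R) (w : Omega) : R :=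
  mean (fun s => f (tau (s *: d) w)).

Lemma mean_along_bounds d (f : Omega -> R) (m M : R) w : continuous f ->
  (forall s : R, 0 <= s <= 1 -> m <= f (tau (s *: d) w) <= M) ->
  m <= mean_along d f w <= M.
Proof. by move=> cf; apply: mean_bounds; exact: continuous_ray_at. Qed.

Lemma mean_along_linear d (a : R) (f g : Omega -> R) w : continuous f -> continuous g ->
  mean_along d (fun x => a * f x + g x) w = a * mean_along d f w + mean_along d g w.
Proof. by move=> cf cg; apply: mean_linear; exact: continuous_ray_at. Qed.

Lemma mean_along_flow d f x w :
  mean_along d f (tau x w) = mean_along d (fun w => f (tau x w)) w.
Proof.
by congr mean; apply/funext => s; rewrite -!tauD addrC.
Qed.

Lemma mean_along_continuous d (f : Omega -> R) : continuous f -> continuous (mean_along d f).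
Proof.
move=> cf w; apply/cvgrPdist_le => e e0.
have := compact_tube w (@segment_compact R 0 1) (@continuous_ray f d cf) e0.
apply: filterS => w' /= h.
have E : mean_along d f w - mean_along d f w' =
    mean (fun s => - 1 * f (tau (s *: d) w') + f (tau (s *: d) w)).
  by rewrite mean_linear; [rewrite /mean_along; ring|exact: continuous_ray_at..].
rewrite E ler_norml; apply: mean_bounds.
  move=> s; apply: cvgD; last exact: continuous_ray_at.
  by apply: cvgM; [exact: cvg_cst|exact: continuous_ray_at].
move=> s s01; have := h s; rewrite in_itv/= => /(_ s01) /ltW.
by rewrite ler_norml => /andP[h1 h2]; apply/andP; lra.
Qed.

(** The remainder is uniform in [w], so that it survives averaging and so that increments in several
    directions can be chained at moving base points. *)
Definition flow_derivative (d : V) (f g : Omega -> R) : Prop :=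
  continuous g /\ forall e : R, 0 < e -> \forall t \near (0 : R),
    forall w, `|f (tau (t *: d) w) - f w - t * g w| <= e * `|t|.

(** The translations commute, so the remainder of the mean is the mean of the remainders and obeys
    the same bound. *)
Lemma mean_along_flow_derivative d d' (f g : Omega -> R) : continuous f ->
  flow_derivative d' f g -> flow_derivative d' (mean_along d f) (mean_along d g).
Proof.
move=> cf [cg fg]; split; first exact: mean_along_continuous.
move=> e e0; apply: filterS (fg e e0) => t ht w.
have cft : continuous (fun w => f (tau (t *: d') w)).
  move=> x; apply: (@continuous_comp _ _ _ (tau (t *: d')) f); last exact: cf.
  exact: continuous_flow_at.
have cgf : continuous (fun w => t * g w + f w).
  move=> x; apply: cvgD; last exact: cf.
  by apply: cvgM; [exact: cvg_cst|exact: cg].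
rewrite mean_along_flow.
have -> : mean_along d (fun w => f (tau (t *: d') w)) w - mean_along d f w -
    t * mean_along d g w =
    mean_along d (fun w => - 1 * (t * g w + f w) + f (tau (t *: d') w)) w.
  by rewrite mean_along_linear// mean_along_linear//; ring.
rewrite ler_norml; apply: mean_along_bounds.
  move=> x; apply: cvgD; last exact: cft.
  by apply: cvgM; [exact: cvg_cst|exact: cgf].
move=> s _; have := ht (tau (s *: d) w).
by rewrite ler_norml => /andP[h1 h2]; apply/andP; lra.
Qed.

(** Moving the segment by [t *: d] shifts its parameter by [t / r]; by [mean_shift] only values of
    [f] close to the two end points remain, and [f] is uniformly continuous along the flow. *)
Lemma flow_derivative_mean_along d (f : Omega -> R) (r : R) : 0 < r -> continuous f ->
  flow_derivative d (mean_along (r *: d) f)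
    (fun w => r^-1 * (f (tau (r *: d) w) - f w)).
Proof.
move=> r0 cf; split.
  move=> w; apply: cvgM; first exact: cvg_cst.
  apply: cvgB; last exact: cf.
  apply: (@continuous_comp _ _ _ (tau (r *: d)) f); last exact: cf.
  exact: continuous_flow_at.
move=> e e0.
have e1 : 0 < e * r / 2 by rewrite divr_gt0// mulr_gt0.
have := flow_uniform cf e1 => /nbhs_ballP[del /= del0 hdel].
(* Below [r] the shift [t / r] is less than 1; below the second bound a displacement [s *: d] stays
   within [del]. *)
pose k := Num.min r (del / (`|d| + 1)).
have d1 : 0 < `|d| + 1 by rewrite ltr_wpDl.
have k0 : 0 < k by rewrite lt_min r0/= divr_gt0.
have hk (s : R) : `|s| < k -> forall w, `|f (tau (s *: d) w) - f w| < e * r / 2.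
  move=> sk; apply: hdel; rewrite -ball_normE/= sub0r normrN normrZ.
  have : `|s| < del / (`|d| + 1) by apply: lt_le_trans sk _; rewrite ge_min lexx orbT.
  rewrite ltr_pdivlMr// => /le_lt_trans; apply.
  by rewrite ler_wpM2l// lerDl.
near=> t => w.
have tk : `|t| < k.
  near: t; apply/nbhs_normP; by exists k => // t; rewrite /ball_/= sub0r normrN.
have tr : `|t / r| < 1.
  rewrite normrM normfV (gtr0_norm r0) ltr_pdivrMr// mul1r.
  by apply: lt_le_trans tk _; rewrite ge_min lexx.
have [a [b [ha hb E]]] := mean_shift (@continuous_ray_at f (r *: d) w cf) tr.
have -> : mean_along (r *: d) f (tau (t *: d) w) =
    mean (fun x => f (tau ((x + t / r) *: (r *: d)) w)).
  congr mean; apply/funext => x; rewrite -tauD; congr (f (tau _ _)).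
  by rewrite scalerDl [(t / r) *: _]scalerA divfK// gt_eqF.
rewrite {1}/mean_along E.
have hs c : `|c| <= `|t / r| -> `|c * r| < k.
  move=> hc; apply: le_lt_trans tk; rewrite normrM (gtr0_norm r0).
  apply: (@le_trans _ _ (`|t / r| * r)); first by rewrite ler_wpM2r// ltW.
  by rewrite normrM normfV (gtr0_norm r0) divfK// gt_eqF.
have h1 := hk _ (hs _ ha) (tau (r *: d) w).
have h2 := hk _ (hs _ hb) w.
rewrite !scalerA !mulrDl mul1r [r + _]addrC scalerDl tauD.
have -> : t / r * (f (tau ((a * r) *: d) (tau (r *: d) w)) - f (tau ((b * r) *: d) w)) -
   t * (r^-1 * (f (tau (r *: d) w) - f w)) = t / r *
   ((f (tau ((a * r) *: d) (tau (r *: d) w)) - f (tau (r *: d) w)) -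
    (f (tau ((b * r) *: d) w) - f w)) by ring.
rewrite normrM normrM normfV (gtr0_norm r0) mulrAC ler_pdivrMr//.
rewrite mulrC [leRHS]mulrAC ler_wpM2r//.
apply: le_trans (ler_normB _ _) _.
by rewrite ltW//; move: h1 h2; lra.
Unshelve. all: by end_near. Qed.

End Flow.

(** * Stationary functions of class C^1, seen as functions on [Omega] *)

Section StationaryFunctions.
Context {R : realType} {n : nat} {Omega : pmetricType R}.
Local Notation V := 'rV[R]_n.
Variable tau : V -> Omega -> Omega.
Hypothesis Omega_compact : compact [set: Omega].
Hypothesis tau_action : continuous_action tau.

Let tauD x y w : tau (x + y) w = tau x (tau y w).
Proof. by case: tau_action. Qed.
Let tau0 w : tau 0 w = w.
Proof. by case: tau_action. Qed.

Lemma near_coord (P : R -> Prop) (i : 'I_n) : (\forall t \near (0 : R), P t) ->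
  \forall y \near (0 : V), P ((y : V) ord0 i).
Proof.
move=> nP; have := @coord_continuous R 1 n ord0 i (0 : V).
by move=> /(_ P); apply; rewrite mxE.
Qed.

(** The coordinates are moved one at a time. One third of [e] pays for the partial increment at the
    already displaced point, one for the remaining coordinates, one for the variation of the partial
    derivative under the displacement. *)
Lemma flow_differential_partial (f : Omega -> R) (g : Omega -> V) (s : seq 'I_n) :
  continuous f ->
  (forall i, flow_derivative tau (delta_mx ord0 i) f (fun w => g w ord0 i)) ->
  forall e : R, 0 < e -> \forall y \near (0 : V), forall w,
    `|f (tau (\sum_(i <- s) (y : V) ord0 i *: delta_mx ord0 i) w) - f w -
      \sum_(i <- s) y ord0 i * g w ord0 i| <= e * `|y|.
Proof.
move=> cf fg; elim: s => [|i s IHs] e e0.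
  by near=> y => w; rewrite !big_nil tau0 subrr subr0 normr0 mulr_ge0// ltW.
have e3 : 0 < e / 3 by rewrite divr_gt0.
have [cgi /(_ _ e3) /(near_coord i) h1] := fg i.
have h2 := IHs _ e3.
pose z (y : V) : V := \sum_(i <- s) y ord0 i *: delta_mx ord0 i.
have h3 : \forall y \near (0 : V), forall w, `|g (tau (z y) w) ord0 i - g w ord0 i| < e / 3.
  have cz : continuous z.
    apply: continuous_row => k.
    have -> : (fun y => z y ord0 k) =
        (fun y : V => \sum_(j <- s) y ord0 j * (delta_mx ord0 j : V) ord0 k).
      by apply/funext => y; rewrite /z summxE; apply: eq_bigr => j _; rewrite mxE.
    apply: continuous_sum => j; apply: continuous_mul; last exact: cst_continuous.
    exact: coord_continuous.
  have z0 : z 0 = 0 by rewrite /z big1// => j _; rewrite mxE scale0r.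
  have nA := flow_uniform Omega_compact tau_action cgi e3.
  have := cz (0 : V); rewrite /continuous_at z0 => cz0.
  exact: (cz0 _ nA).
apply: filterS3 h1 h2 h3 => y h1 h2 h3 w.
rewrite !big_cons tauD -/(z y).
have a1 := h1 (tau (z y) w); have a2 := h2 w.
have a3 : `|y ord0 i * (g (tau (z y) w) ord0 i - g w ord0 i)| <= `|y| * (e / 3).
  rewrite normrM; apply: ler_pM => //; first exact: row_coord_le.
  by apply: ltW; exact: h3.
have a4 : e / 3 * `|y ord0 i| <= e / 3 * `|y|.
  by rewrite ler_pM2l//; exact: row_coord_le.
move: a1 a2 a3 a4; rewrite -/(z y); set A := f _; set B := f _; set C := \sum_(_ <- _) _.
set D := g _ _ _; set E := g _ _ _; set F := f w; set c := y ord0 i.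
rewrite !ler_norml => /andP[? ?] /andP[? ?] /andP[? ?] ?.
by apply/andP; lra.
Unshelve. all: by end_near. Qed.

Lemma flow_differential (f : Omega -> R) (g : Omega -> V) : continuous f ->
  (forall i, flow_derivative tau (delta_mx ord0 i) f (fun w => g w ord0 i)) ->
  forall e : R, 0 < e -> \forall y \near (0 : V), forall w,
    `|f (tau y w) - f w - dotv y (g w)| <= e * `|y|.
Proof.
move=> cf fg e e0.
apply: filterS (flow_differential_partial (index_enum 'I_n) cf fg e0) => y h w.
by rewrite {1}[y]row_sum_delta; exact: h.
Qed.

Section FlowC1.
Variables (f : Omega -> R) (g : Omega -> V).
Hypothesis cf : continuous f.
Hypothesis fg : forall i, flow_derivative tau (delta_mx ord0 i) f (fun w => g w ord0 i).

Let phi (x : V) (w : Omega) : R := f (tau x w).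

Let g_cont : continuous g.
Proof. by apply: continuous_row => i; case: (fg i). Qed.

Let phi_diff x w : differentiable (phi^~ w) x /\
  'd (phi^~ w) x = dotr (g (tau x w)) :> (V -> R).
Proof.
have cd : continuous (dotr (g (tau x w))).
  by apply: continuous_dotv; [exact: continuous_id|exact: cst_continuous].
have E : phi^~ w \o shift x = cst (phi x w) + dotr (g (tau x w)) +o_ 0 id.
  apply/eqaddoP => e e0.
  have := flow_differential cf fg e0; apply: filterS => y h.
  by have := h (tau x w); rewrite -tauD -addrA -opprD.
have dE := diff_unique cd E.
split => //; apply/diff_locallyP; rewrite dE; split => //.
Qed.

Let phi_derive v x w : 'D_v (phi^~ w) x = dotv v (g (tau x w)).
Proof. by have [h1 h2] := phi_diff x w; rewrite deriveE// h2. Qed.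

Lemma flow_grad w : grad (phi^~ w) 0 = g w.
Proof. by apply/rowP => i; rewrite mxE phi_derive tau0 dotv_delta. Qed.

(** The differential at [x] is the pairing with [g] evaluated at [tau x w], so its continuity in [x]
    is that of the action and of [g]. *)
Lemma flow_C1s : C1s tau phi.
Proof.
split.
- by move=> x y w; rewrite /phi tauD.
- move=> w; split => [x|v]; first exact: (phi_diff x w).1.
  rewrite /=; under eq_fun do rewrite phi_derive.
  apply: continuous_dotv; first exact: cst_continuous.
  apply: (@continuous_compose _ _ _ (fun x => tau x w) g) => //.
  apply: (@continuous_compose _ _ _ (fun x => (x, w)) (fun p : V * Omega => tau p.1 p.2)).
    by apply: continuous_pair; [exact: continuous_id|exact: cst_continuous].
  by case: tau_action.
- by move=> x; apply: (@continuous_compose _ _ _ (tau x) f) => //; exact: continuous_flow_at.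
- by under eq_fun do rewrite flow_grad.
Qed.

End FlowC1.

Section C1sTheory.
Variable phi : V -> Omega -> R.
Hypothesis C1phi : C1s tau phi.

Lemma C1s_at0 x w : phi x w = phi 0 (tau x w).
Proof. by rewrite -(C1s_stationary C1phi) add0r. Qed.

Lemma C1s_differentiable w x : differentiable (phi^~ w) x.
Proof. by have [] := C1s_C1 C1phi w. Qed.

Lemma C1s_derive v x w : 'D_v (phi^~ w) x = dotv v (grad (phi^~ (tau x w)) 0).
Proof.
have -> : 'D_v (phi^~ w) x = 'D_v (phi^~ (tau x w)) 0.
  rewrite /derive; suff -> : (fun h : R => h^-1 *: (((phi^~ w) \o shift x) (h *: v) - phi x w)) =
      (fun h => h^-1 *: (((phi^~ (tau x w)) \o shift 0) (h *: v) - phi 0 (tau x w))) by [].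
  apply/funext => h /=.
  by rewrite (C1s_stationary C1phi) addr0 -[in phi x w](add0r x) (C1s_stationary C1phi).
rewrite deriveE; last exact: C1s_differentiable.
rewrite {1}[v]row_sum_delta linear_sum/=; apply: eq_bigr => i _.
by rewrite linearZ mxE -deriveE//; exact: C1s_differentiable.
Qed.

Lemma C1s_ray (v : V) w (s : R) :
  is_derive s 1 (fun s => phi 0 (tau (s *: v) w)) (dotv v (grad (phi^~ (tau (s *: v) w)) 0)).
Proof.
have E : (fun h : R => h^-1 *: ((fun s => phi 0 (tau (s *: v) w)) (h *: 1 + s) -
    (fun s => phi 0 (tau (s *: v) w)) s)) =
    (fun h => h^-1 *: (phi (h *: v + s *: v) w - phi (s *: v) w)).
  by apply/funext => h; rewrite -!C1s_at0 scalerDl [h *: 1]mulr1.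
rewrite -C1s_derive; split.
- rewrite /derivable /= E.
  have : derivable (phi^~ w) (s *: v) v by apply: diff_derivable; exact: C1s_differentiable.
  exact.
- by rewrite /derive /= E.
Qed.

Lemma C1s_ray_MVT (v : V) w (t : R) : 0 < t -> exists2 s, 0 < s < t &
  phi 0 (tau (t *: v) w) - phi 0 w = t * dotv v (grad (phi^~ (tau (s *: v) w)) 0).
Proof.
move=> t0.
have [|c] := @MVT R (fun s => phi 0 (tau (s *: v) w)) _ 0 t t0 (fun x _ => C1s_ray v w x).
  apply: derivable_within_continuous => x _.
  by have [] := C1s_ray v w x.
rewrite in_itv/= scale0r tau0 subr0 => c0t ->.
by exists c => //; rewrite mulrC.
Qed.

Lemma C1s_pairing_continuous :
  continuous (fun p : V * Omega => dotv p.1 (grad (phi^~ p.2) 0)).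
Proof.
apply: continuous_dotv => [p|]; first exact: cvg_fst.
apply: (@continuous_compose _ _ _ snd (fun w => grad (phi^~ w) 0)).
  by move=> p; exact: cvg_snd.
exact: C1s_grad_continuous C1phi.
Qed.

End C1sTheory.

Lemma grad_lin (a : R) (phi psi : V -> Omega -> R) w :
  C1s tau phi -> C1s tau psi ->
  grad ((fun x w => a * phi x w + psi x w)^~ w) 0 =
  a *: grad (phi^~ w) 0 + grad (psi^~ w) 0.
Proof.
move=> C1 C2; apply/rowP => i; rewrite !mxE.
have d1 : derivable (phi^~ w) 0 (delta_mx ord0 i).
  apply: diff_derivable; exact: C1s_differentiable.
have d2 : derivable (psi^~ w) 0 (delta_mx ord0 i).
  apply: diff_derivable; exact: C1s_differentiable.
rewrite -[LHS]/('D_(delta_mx ord0 i) (a *: (phi^~ w) + (psi^~ w)) 0).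
by rewrite deriveD ?deriveZ//; exact: derivableZ.
Qed.

Lemma C1s_lin (a : R) (phi psi : V -> Omega -> R) : C1s tau phi -> C1s tau psi ->
  C1s tau (fun x w => a * phi x w + psi x w).
Proof.
move=> C1 C2; split.
- by move=> x y w; rewrite (C1s_stationary C1) (C1s_stationary C2).
- move=> w; split=> [x|v].
    rewrite -[fun _ => _]/(a *: (phi^~ w) + (psi^~ w)).
    apply: differentiableD; last exact: C1s_differentiable C2 w x.
    by apply: differentiableZ; exact: C1s_differentiable C1 w x.
  have -> : (fun x => 'D_v (fun x => a * phi x w + psi x w) x) =
      (fun x => a * 'D_v (phi^~ w) x + 'D_v (psi^~ w) x).
    apply/funext => x.
    rewrite -[LHS]/('D_v (a *: (phi^~ w) + (psi^~ w)) x).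
    have d1 : derivable (phi^~ w) x v by apply: diff_derivable; exact: C1s_differentiable.
    have d2 : derivable (psi^~ w) x v by apply: diff_derivable; exact: C1s_differentiable.
    by rewrite deriveD ?deriveZ//; exact: derivableZ.
  apply: continuous_add; last exact: (C1s_C1 C2 w).2.
  by apply: continuous_mul; [exact: cst_continuous|exact: (C1s_C1 C1 w).2].
- move=> x w; apply: cvgD; last exact: C1s_continuous C2 x w.
  by apply: cvgM; [exact: cvg_cst|exact: C1s_continuous C1 x w].
- under eq_fun do rewrite grad_lin//.
  move=> w; apply: cvgD; last exact: C1s_grad_continuous C2 w.
  by apply: cvgZl_tmp; exact: C1s_grad_continuous C1 w.
Qed.

Lemma grad_cst (c : R) : grad (fun _ : V => c) 0 = 0.
Proof. by apply/rowP => i; rewrite !mxE derive_cst. Qed.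

Lemma C1s_cst (c : R) : C1s tau (fun _ _ => c).
Proof.
split => //.
- move=> w; split => [x|v]; first exact: differentiable_cst.
  by under eq_fun do rewrite derive_cst; exact: cst_continuous.
- by move=> x w; exact: cvg_cst.
- have -> : (fun w : Omega => grad ((fun (_ : V) (_ : Omega) => c)^~ w) 0) = (fun=> 0).
    by apply/funext => w; exact: grad_cst.
  exact: cst_continuous.
Qed.

End StationaryFunctions.

(** * The discounted value function *)

Lemma row_ball_compact {R : realType} {n : nat} (r : R) : compact [set v : 'rV[R]_n | `|v| <= r].
Proof.
apply: bounded_closed_compact.
  by exists r; split; [exact: num_real|move=> M rM v /= /le_trans; apply; exact: ltW].
apply: (@closed_comp _ _ (fun v : 'rV[R]_n => `|v|) [set x | x <= r]); last exact: closed_le.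
by move=> v _; exact: norm_continuous.
Qed.

Section Lagrangian.
Context {R : realType} {n : nat} {Omega : pmetricType R}.
Local Notation V := 'rV[R]_n.
Variables (tau : V -> Omega -> Omega) (L : V -> V -> Omega -> R).
Hypothesis Omega_compact : compact [set: Omega].
Hypothesis tau_action : continuous_action tau.
Hypothesis L_lag : lagrangian tau L.

Lemma lag_continuous0 : continuous (fun p : V * Omega => L 0 p.1 p.2).
Proof.
apply: (@continuous_compose _ _ _ (fun p : V * Omega => ((0 : V, p.1), p.2))
  (fun p : V * V * Omega => L p.1.1 p.1.2 p.2)); last exact: lag_continuous L_lag.
apply: continuous_pair; last by move=> p; exact: cvg_snd.
by apply: continuous_pair => p; [exact: cvg_cst|exact: cvg_fst].
Qed.

Lemma velocity_ball_compact (r : R) : compact [set p : V * Omega | `|p.1| <= r].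
Proof.
have -> : [set p : V * Omega | `|p.1| <= r] = [set v | `|v| <= r] `*` setT.
  by apply/seteqP; split => -[v w] //= -[].
by apply: compact_setX => //; exact: row_ball_compact.
Qed.

Lemma lag_orbit x v w : L 0 v (tau x w) = L x v w.
Proof. by rewrite -(lag_stationary L_lag) add0r. Qed.

Lemma lag_bounded (r : R) : exists2 c : R, 0 <= c &
  forall v w, `|v| <= r -> L 0 v w <= c.
Proof.
have [c c0 hc] := compact_bounded_above (velocity_ball_compact (r := r)) lag_continuous0.
by exists c => // v w vr; apply: le_trans (ler_norm _) _; exact: (hc (v, w)).
Qed.

(* Superlinearity is assumed pointwise in [w]; convexity along rays makes it
   uniform, since it is enough to control [L] on a single sphere. *)
Lemma lag_superlinear_uniform (A : R) : exists2 r : R, 1 <= r &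
  forall v w, r <= `|v| -> A * `|v| <= L 0 v w.
Proof.
have [C0 C00 hC0] := lag_bounded 0.
suff : \forall j \near \oo, [set: Omega] `<=` [set w | forall v, j%:R <= `|v| -> A * `|v| <= L 0 v w].
  move=> [N _ hN]; exists N.+1%:R; first by rewrite ler1n.
  by move=> v w; exact: (hN N.+1 (leqnSn N) w I).
apply: (proj1 (compact_near_coveringP setT) Omega_compact) => w0 _.
(* The 1 pays for replacing [w0] by a nearby [w], and [C0] for the value of [L] at zero velocity in
   the convexity inequality; [r1 >= 1] lets both be charged to [A' * r1]. *)
pose A' := `|A| + 1 + C0.
have A'0 : 0 <= A' by rewrite !addr_ge0.
have [r r0 hr] := lag_superlinear L_lag 0 w0 A'.
pose r1 := Num.max r 1.
have r1r : r <= r1 by rewrite le_max lexx.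
have r11 : 1 <= r1 by rewrite le_max lexx orbT.
have r10 : 0 < r1 by exact: lt_le_trans r11.
have cF : continuous (fun p : Omega * V => L 0 p.2 p.1).
  apply: (@continuous_compose _ _ _ (fun p : Omega * V => (p.2, p.1))
    (fun p : V * Omega => L 0 p.1 p.2)); last exact: lag_continuous0.
  by apply: continuous_pair => p; [exact: cvg_snd|exact: cvg_fst].
have tube := compact_tube w0 (@row_ball_compact R n r1) cF ltr01.
have sph v : `|v| = r1 -> A' * r1 <= L 0 v w0.
  move=> vr; have ev : r1 <= enorm v by rewrite -vr; exact: row_norm_le_enorm.
  have e0 : 0 < enorm v by exact: lt_le_trans ev.
  have := hr v (le_trans r1r ev); rewrite ler_pdivlMr//; apply: le_trans.
  by rewrite ler_wpM2l.
near=> w j => /= v jv.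
have r1v : r1 <= `|v|.
  by apply: le_trans jv; near: j; exact: nbhs_infty_ger.
have v0 : 0 < `|v| by exact: lt_le_trans r1v.
pose v' := (r1 / `|v|) *: v.
have nv' : `|v'| = r1.
  by rewrite normrZ ger0_norm ?divfK ?gt_eqF// divr_ge0// ltW.
have Lv' : A' * r1 - 1 <= L 0 v' w.
  have tw : forall x : V, [set v : V | `|v| <= r1] x -> `|L 0 x w - L 0 x w0| < 1.
    by near: w; exact: tube.
  have /tw : [set v : V | `|v| <= r1] v' by rewrite /= nv'.
  by rewrite ltr_norml => /andP[+ _]; have := sph _ nv'; lra.
(* The point [v'] of norm [r1] lies on the segment from 0 to [v]. When it equals [v], strict
   convexity says nothing and the bound is direct. *)
have conv : L 0 v' w <= (r1 / `|v|) * L 0 v w + C0.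
  have [E|ne] := eqVneq `|v| r1.
    by rewrite /v' E divff ?gt_eqF// scale1r mul1r lerDl.
  have lt1 : r1 / `|v| < 1 by rewrite ltr_pdivrMr// mul1r lt_neqAle eq_sym ne.
  have gt0 : 0 < r1 / `|v| by rewrite divr_gt0.
  have nz : v != 0 by rewrite -normr_gt0.
  have := lag_strictly_convex L_lag 0 w nz (_ : 0 < r1 / `|v| < 1).
  rewrite scaler0 addr0 gt0 lt1 => /(_ isT) /ltW /le_trans; apply.
  rewrite lerD2l; apply: le_trans (hC0 0 w _); last by rewrite normr0.
  by rewrite ler_piMl ?(lag_ge0 L_lag)// gerBl ltW.
have h : (A' - 1 - C0) * r1 <= (r1 / `|v|) * L 0 v w.
  have : (A' - 1 - C0) * r1 <= A' * r1 - 1 - C0.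
    rewrite -addrA mulrDl -[leRHS]addrA lerD2l -opprD mulNr lerN2.
    by rewrite ler_peMr// addr_ge0.
  by move: Lv' conv; lra.
have -> : L 0 v w = `|v| / r1 * (r1 / `|v| * L 0 v w).
  by rewrite mulrA mulf_div [`|v| * r1]mulrC divff ?mul1r// mulf_neq0 ?gt_eqF.
apply: (@le_trans _ _ (`|v| / r1 * ((A' - 1 - C0) * r1))); last first.
  by rewrite ler_wpM2l// divr_ge0// ltW.
have -> : A' - 1 - C0 = `|A| by rewrite /A'; ring.
rewrite [_ * r1]mulrC mulrA divfK ?gt_eqF// mulrC ler_wpM2l//.
exact: ler_norm.
Unshelve. all: by end_near. Qed.

End Lagrangian.

(** * Subsolutions in increment form and their supremum *)

Section ValueFunction.
Context {R : realType} {n : nat} {Omega : pmetricType R}.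
Local Notation V := 'rV[R]_n.
Variables (tau : V -> Omega -> Omega) (L : V -> V -> Omega -> R) (alpha : R).
Hypothesis Omega_compact : compact [set: Omega].
Hypothesis tau_action : continuous_action tau.
Hypothesis L_lag : lagrangian tau L.
Hypothesis alpha_gt0 : 0 < alpha.
Variables (rad M : R).
Hypothesis rad_ge1 : 1 <= rad.
Hypothesis M_ge0 : 0 <= M.

Let tauD x y w : tau (x + y) w = tau x (tau y w).
Proof. by case: tau_action. Qed.
Let tau0 w : tau 0 w = w.
Proof. by case: tau_action. Qed.

(** Steps of this length keep [1 - alpha * t] nonnegative, which makes the increment form monotone
    in its right-hand side; the exact value [alpha * t0 = 1 / 2] later fixes [M]. *)
Let t0 : R := (2 * alpha)^-1.

Let t0_gt0 : 0 < t0.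
Proof. by rewrite invr_gt0 mulr_gt0. Qed.

Let at_le (t : R) : t <= t0 -> alpha * t <= 1 / 2.
Proof.
by rewrite /t0 -ler_pdivlMl// [alpha^-1 * _]mulrC mul1r invfM.
Qed.

(* Finite-increment form of [alpha w - v . D w <= L + e], which is stable under
   arbitrary suprema. *)
Definition subsolution (e : R) (w : Omega -> R) : Prop :=
  forall om v (t : R), `|v| <= rad -> 0 < t <= t0 ->
    w om <= t * (L 0 v om + e) + M * t ^+ 2 + (1 - alpha * t) * w (tau (t *: v) om).

(** No continuity is asked of the competitors. Their nonnegativity costs nothing, as 0 is a
    subsolution because [L >= 0], and the positive part of a subsolution is again one. *)
Definition value (om : Omega) : R :=
  sup [set w om | w in [set w | (forall om, 0 <= w om) /\ subsolution 0 w]].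

(** At zero velocity the orbit does not move, and the increment form divided by [t] reads
    [alpha * w <= L + M * t]; [t] is taken so small that [M * t <= e]. *)
Lemma subsolution_le (w : Omega -> R) (c : R) om : subsolution 0 w ->
  L 0 0 om <= c -> alpha * w om <= c.
Proof.
move=> sw Lc; apply/ler_addgt0Pr => e e0.
pose t := Num.min t0 (e / (M + 1)).
have M1 : 0 < M + 1 by rewrite ltr_wpDl.
have tp : 0 < t by rewrite lt_min t0_gt0 divr_gt0.
have tt : t <= t0 by rewrite ge_min lexx.
have te : M * t <= e.
  apply: (@le_trans _ _ ((M + 1) * t)); first by rewrite ler_wpM2r ?lerDl// ltW.
  by rewrite -ler_pdivlMl// mulrC ge_min lexx orbT.
have := sw om 0 t; rewrite normr0 tp tt scaler0 tau0.
move=> /(_ (le_trans ler01 rad_ge1) isT) h.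
have : t * (alpha * w om) <= t * (L 0 0 om + M * t).
  by move: h; rewrite expr2; lra.
by rewrite ler_pM2l//; lra.
Qed.

Let bound : exists2 c : R, 0 <= c & forall om, L 0 0 om <= c.
Proof.
have [c c0 hc] := lag_bounded Omega_compact L_lag 0.
by exists c => // om; apply: hc; rewrite normr0.
Qed.

Let zero_sub : subsolution 0 (fun=> 0).
Proof.
move=> om v t _ /andP[tp _]; rewrite mulr0 !addr0 addr_ge0//.
  by rewrite mulr_ge0 ?(lag_ge0 L_lag)// ltW.
by rewrite mulr_ge0// sqr_ge0.
Qed.

Let has_sup_value om :
  has_sup [set w om | w in [set w | (forall om, 0 <= w om) /\ subsolution 0 w]].
Proof.
split; first by exists 0, (fun=> 0).
have [c _ hc] := bound; exists (c / alpha) => _ [w [_ sw] <-].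
by rewrite ler_pdivlMr// mulrC; exact: subsolution_le.
Qed.

Let value_ub w om : (forall om, 0 <= w om) -> subsolution 0 w -> w om <= value om.
Proof. by move=> w0 sw; apply: ub_le_sup; [exact: (has_sup_value om).2|exists w]. Qed.

Lemma value_ge0 om : 0 <= value om.
Proof. exact: (@value_ub (fun=> 0)). Qed.

Lemma value_subsolution : subsolution 0 value.
Proof.
move=> om v t vr tt; apply: ge_sup; first exact: (has_sup_value om).1.
move=> _ [w [w0 sw] <-]; apply: le_trans (sw om v t vr tt) _.
rewrite lerD2l ler_wpM2l//; last exact: value_ub.
by have /andP[_ /at_le] := tt; lra.
Qed.

Lemma subsolution_le_value w om : subsolution 0 w -> w om <= value om.
Proof.
move=> sw; apply: (@le_trans _ _ (Num.max (w om) 0)); first by rewrite le_max lexx.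
apply: (@value_ub (fun om => Num.max (w om) 0)) => [om'|om' v t vr tt].
  by rewrite le_max lexx orbT.
have at1 : 0 <= 1 - alpha * t by have /andP[_ /at_le] := tt; lra.
rewrite ge_max; apply/andP; split.
  apply: le_trans (sw om' v t vr tt) _.
  by rewrite lerD2l ler_wpM2l// le_max lexx.
apply: le_trans (zero_sub om' vr tt) _.
by rewrite lerD2l ler_wpM2l// le_max lexx orbT.
Qed.

Lemma value_le (c : R) om : L 0 0 om <= c -> alpha * value om <= c.
Proof. by move=> h; apply: subsolution_le => //; exact: value_subsolution. Qed.

(* The value of [om1] along its orbit, lowered by [eta |x|] and transported to
   the orbit of [om2], is a subsolution where it is positive. *)
Lemma value_transport om1 om2 (c eta e : R) : (forall om, L 0 0 om <= c) ->
  0 < eta -> 0 <= e ->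
  (forall x v, `|x| <= c / (alpha * eta) -> `|v| <= rad -> L x v om1 <= L x v om2 + e) ->
  value om1 - (e + eta * rad) / alpha <= value om2.
Proof.
move=> hc eta0 e0 hL.
(* Over a step [t] the discount turns the lowering by [k] into a gain of [t * alpha * k], which pays
   [t * e] for the change of Lagrangian and [t * eta * rad] for the change of the penalty. *)
pose k := (e + eta * rad) / alpha.
have ak : alpha * k = e + eta * rad by rewrite mulrC divfK// gt_eqF.
(* All [x] leading from [om2] to [om] compete, since the orbit may return; 0 serves the points off
   the orbit and those where the lowered value is negative. *)
pose S om : set R := [set a | a = 0 \/
  exists2 x, tau x om2 = om & a = value (tau x om1) - k - eta * `|x|].
have k0 : 0 <= k.
  by rewrite divr_ge0 ?(ltW alpha_gt0)// addr_ge0// mulr_ge0 ?(ltW eta0)// (le_trans ler01).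
have vc om : value om <= c / alpha.
  by rewrite ler_pdivlMr// mulrC value_le.
have hS om : has_sup (S om).
  split; first by exists 0; left.
  exists (c / alpha) => a [->|[x _ ->]]; first exact: le_trans (value_ge0 om) (vc om).
  apply: le_trans (vc (tau x om1)).
  by rewrite -addrA gerDl -opprD oppr_le0 addr_ge0// mulr_ge0// ltW.
pose w om := sup (S om).
have w_ub om a : S om a -> a <= w om.
  by move=> Sa; apply: ub_le_sup => //; exact: (hS om).2.
have w0 om : 0 <= w om by apply: w_ub; left.
have sw : subsolution 0 w.
  move=> om v t vr tt; have /andP[tp tle] := tt.
  have at1 : 0 <= 1 - alpha * t by have := at_le tle; lra.
  have rhs0 : 0 <= t * (L 0 v om + 0) + M * t ^+ 2 + (1 - alpha * t) * w (tau (t *: v) om).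
    rewrite addr0 !addr_ge0//; first by rewrite mulr_ge0 ?(lag_ge0 L_lag)// ltW.
      by rewrite mulr_ge0// sqr_ge0.
    by rewrite mulr_ge0.
  apply: ge_sup; first exact: (hS om).1.
  move=> a [->//|[x xom ->]].
  (* Where the lowered value is positive, [eta * |x|] is at most the bound [c / alpha] of [value];
     hence the Lagrangians are compared only for bounded [x]. *)
  have [neg|pos] := leP (value (tau x om1) - k - eta * `|x|) 0; first exact: le_trans rhs0.
  have xr : `|x| <= c / (alpha * eta).
    rewrite invfM mulrA ler_pdivlMr// mulrC.
    by have := vc (tau x om1); move: pos k0; lra.
  have := value_subsolution (tau x om1) vr tt.
  rewrite addr0 (lag_orbit L_lag) => h1.
  have h2 := hL x v xr vr.
  have h3 : value (tau (t *: v) (tau x om1)) - k - eta * `|t *: v + x| <= w (tau (t *: v) om).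
    by apply: w_ub; right; exists (t *: v + x); rewrite tauD// xom.
  have h4 : `|t *: v + x| <= t * rad + `|x|.
    apply: le_trans (ler_normD _ _) _; rewrite lerD2r normrZ gtr0_norm//.
    by rewrite ler_pM2l.
  rewrite -xom (lag_orbit L_lag) xom addr0.
  have h2' : t * L x v om1 <= t * L x v om2 + t * e.
    by rewrite -mulrDr ler_pM2l.
  have h3' := ler_wpM2l at1 h3.
  have h4' : (1 - alpha * t) * (eta * `|t *: v + x|) <= eta * (t * rad + `|x|).
    apply: (@le_trans _ _ (eta * `|t *: v + x|)).
      apply: ler_piMl; first by rewrite mulr_ge0// ltW.
      by rewrite gerBl mulr_ge0// ltW.
    by rewrite ler_pM2l.
  have E : (1 - alpha * t) * (value (tau (t *: v) (tau x om1)) - k - eta * `|t *: v + x|) =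
      (1 - alpha * t) * value (tau (t *: v) (tau x om1)) - k + t * (e + eta * rad)
      - (1 - alpha * t) * (eta * `|t *: v + x|) by rewrite -ak; ring.
  move: h3'; rewrite E => h3'.
  by move: h1 h2' h3' h4'; lra.
apply: le_trans (subsolution_le_value om2 sw).
apply: w_ub; right; exists 0; first exact: tau0.
by rewrite tau0 normr0 mulr0 subr0.
Qed.

(** For [x] and [v] in fixed balls, [L x v] is uniformly close at nearby points of [Omega], so
    [value_transport] applies in both directions. [eta] and [eps] are chosen to contribute [e / 2]
    each. *)
Lemma value_continuous : continuous value.
Proof.
have [c c0 hc] := bound.
move=> om0; apply/cvgrPdist_le => e e0.
pose eta := alpha * e / (2 * rad).
have rad0 : 0 < rad by exact: lt_le_trans rad_ge1.
have eta0 : 0 < eta by rewrite divr_gt0 ?mulr_gt0.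
pose eps := alpha * e / 2.
have eps0 : 0 < eps by rewrite divr_gt0 ?mulr_gt0.
have E : (eps + eta * rad) / alpha = e.
  have : rad != 0 /\ alpha != 0 by rewrite !gt_eqF.
  by move=> [? ?]; rewrite /eps /eta; field; rewrite ?gt_eqF.
pose K : set (V * V) := [set x | `|x| <= c / (alpha * eta)] `*` [set v | `|v| <= rad].
have cK : compact K by apply: compact_setX; exact: row_ball_compact.
have cF : continuous (fun p : Omega * (V * V) => L p.2.1 p.2.2 p.1).
  apply: (@continuous_compose _ _ _ (fun p : Omega * (V * V) => ((p.2.1, p.2.2), p.1))
    (fun p : V * V * Omega => L p.1.1 p.1.2 p.2)); last exact: lag_continuous L_lag.
  apply: continuous_pair; last by move=> p; exact: cvg_fst.
  apply: continuous_pair.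
    apply: (@continuous_compose _ _ _ snd fst) => p; [exact: cvg_snd|exact: cvg_fst].
  apply: (@continuous_compose _ _ _ snd snd) => p; exact: cvg_snd.
apply: filterS (compact_tube om0 cK cF eps0) => om h.
have h1 : value om0 - e <= value om.
  rewrite -E; apply: value_transport hc eta0 (ltW eps0) _ => x v xr vr.
  by have := h (x, v) (conj xr vr); rewrite /= ltr_norml => /andP[? ?]; lra.
have h2 : value om - e <= value om0.
  rewrite -E; apply: value_transport hc eta0 (ltW eps0) _ => x v xr vr.
  by have := h (x, v) (conj xr vr); rewrite /= ltr_norml => /andP[? ?]; lra.
by rewrite ler_norml; apply/andP; lra.
Qed.

(* If [psi] satisfied the strict inequality, the translate of [psi] normalised
   by [max (psi - value) = c / alpha] would be a subsolution exceeding [value]. *)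
Lemma value_maximal (CL ML c : R) (psi : V -> Omega -> R) :
  (forall v om, `|v| <= rad -> L 0 v om <= CL) ->
  (forall v om (s : R), 0 <= s <= t0 -> `|v| <= rad -> L (s *: v) v om <= L 0 v om + s * ML) ->
  0 <= CL -> 0 <= ML -> M = 2 * (ML + alpha * CL) ->
  0 < c -> C1s tau psi ->
  (forall v om, `|v| <= rad ->
    alpha * value om + c - dotv v (grad (psi^~ om) 0) <= L 0 v om) -> False.
Proof.
move=> hCL hML CL0 ML0 ME c0 C1 hpsi.
pose D om := psi 0 om - value om.
have cD : continuous D.
  move=> om; apply: cvgB; last exact: value_continuous.
  have cpsi : continuous (psi 0) by exact: (C1s_continuous C1).
  exact: cpsi.
have [om0 _ hom0] : exists2 om0, om0 \in [set: Omega] &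
    forall om, om \in [set: Omega] -> D om <= D om0.
  have ne : [set: Omega] !=set0 by exists point.
  by have := compact_EVT_max ne Omega_compact (continuous_subspaceT cD).
pose k := c / alpha - D om0.
pose w om := psi 0 om + k.
suff sw : subsolution 0 w.
  have := subsolution_le_value om0 sw.
  have : 0 < c / alpha by rewrite divr_gt0.
  by rewrite /w /k /D; lra.
have wD om : w om <= value om + c / alpha.
  by have := hom0 om; rewrite !inE => /(_ I); rewrite /w /k /D; lra.
move=> om v t vr /andP[tp tle]; rewrite addr0.
have at1 : 0 <= 1 - alpha * t by have := at_le tle; lra.
have [s /andP[sp st] E] := C1s_ray_MVT tau_action C1 v om tp.
set om1 := tau (t *: v) om in E *; set om2 := tau (s *: v) om in E.
have h1 := hpsi v om2 vr.
have h2 : L 0 v om2 <= L 0 v om + t * ML.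
  rewrite /om2 (lag_orbit L_lag); apply: le_trans (hML v om s _ vr) _.
    by rewrite (ltW sp)/= (le_trans (ltW st)).
  by rewrite lerD2l ler_wpM2r// ltW.
(* The inequality for [psi] is available at the intermediate point [om2] given by the mean value
   theorem, whereas the increment form needs [w om1]. The two values are compared by running back
   from [om1] to [om2] with velocity [- v] during the time [t - s]. *)
have h3 : value om1 <= t * (CL + M * t0) + value om2.
  have ts : 0 < t - s <= t0.
    by rewrite subr_gt0 st/= (le_trans _ tle)// gerBl ltW.
  have := value_subsolution om1 (_ : `|- v| <= rad) ts; rewrite normrN => /(_ vr).
  have -> : tau ((t - s) *: - v) om1 = om2.
    by rewrite /om1 /om2 -tauD scalerN -scaleNr -scalerDl opprB subrK.
  rewrite addr0 => /le_trans; apply; apply: lerD.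
    have /andP[ts0 ts1] := ts.
    apply: (@le_trans _ _ ((t - s) * (CL + M * t0))).
      rewrite mulrDr lerD//; first by rewrite ler_pM2l// hCL// normrN.
      by rewrite expr2 mulrCA ler_pM2l// ler_wpM2l.
    rewrite ler_wpM2r ?gerBl ?(ltW sp)// addr_ge0// mulr_ge0// ltW//.
  rewrite ler_piMl ?value_ge0// gerBl mulr_ge0 ?(ltW alpha_gt0)//.
  by have /andP[/ltW] := ts.
(* The second-order errors of [L] and [value] add up to exactly [M], because
   [alpha * t0 = 1 / 2]. *)
have Mt : ML + alpha * (CL + M * t0) = M.
  have : alpha * t0 = 1 / 2 by rewrite /t0; field; rewrite gt_eqF.
  by move=> h; rewrite mulrDr mulrCA h ME; field.
have h4 := wD om1.
have h5 : alpha * w om1 <= alpha * value om1 + c.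
  have := ler_wpM2l (ltW alpha_gt0) h4.
  suff -> : alpha * (value om1 + c / alpha) = alpha * value om1 + c by [].
  by field; rewrite gt_eqF.
have h6 : alpha * value om1 <= alpha * (t * (CL + M * t0)) + alpha * value om2.
  by rewrite -mulrDr ler_wpM2l// ltW.
have h7 : alpha * w om1 - dotv v (grad (psi^~ om2) 0) <= L 0 v om + t * M.
  by rewrite -Mt; move: h1 h2 h5 h6; lra.
have h8 : t * (alpha * w om1 - dotv v (grad (psi^~ om2) 0)) <= t * (L 0 v om + t * M).
  by rewrite ler_pM2l.
have Ew : w om1 - w om = t * dotv v (grad (psi^~ om2) 0).
  by rewrite -E /w; ring.
by move: h8; rewrite [t * (_ - _)]mulrBr -Ew expr2; lra.
Qed.

End ValueFunction.

(** * Smoothing of continuous subsolutions *)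

Section Smoothing.
Context {R : realType} {n : nat} {Omega : pmetricType R}.
Local Notation V := 'rV[R]_n.
Variables (tau : V -> Omega -> Omega) (L : V -> V -> Omega -> R) (alpha : R).
Hypothesis Omega_compact : compact [set: Omega].
Hypothesis tau_action : continuous_action tau.
Hypothesis L_lag : lagrangian tau L.
Hypothesis alpha_gt0 : 0 < alpha.
Variables (rad M : R).
Hypothesis M_ge0 : 0 <= M.

Let tauD x y w : tau (x + y) w = tau x (tau y w).
Proof. by case: tau_action. Qed.

Let subsol := subsolution tau L alpha rad M.
Let basis (i : 'I_n) : V := delta_mx ord0 i.

(** The increment form is affine in [w] and the flow commutes with averaging, so the mean over a
    short segment is a subsolution for the averaged [L], which differs from [L] by at most [e'] when
    [|v| <= rad]. One direction of differentiability is gained and none is lost. *)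
Lemma smoothing_step (e e' : R) (w : Omega -> R) (i : 'I_n) : 0 < e' ->
  continuous w -> (forall om, 0 <= w om) -> subsol e w ->
  exists w' : Omega -> R, [/\ continuous w', forall om, 0 <= w' om,
    forall om, `|w' om - w om| <= e', subsol (e + e') w' &
    (exists g, flow_derivative tau (basis i) w' g) /\
    forall j g, flow_derivative tau (basis j) w g ->
      exists g', flow_derivative tau (basis j) w' g'].
Proof.
move=> e0 cw w0 sw.
have cF : continuous (fun p : V * (V * Omega) => L p.1 p.2.1 p.2.2).
  apply: (@continuous_compose _ _ _ (fun p : V * (V * Omega) => ((p.1, p.2.1), p.2.2))
    (fun p : V * V * Omega => L p.1.1 p.1.2 p.2)); last exact: lag_continuous L_lag.
  apply: continuous_pair.
    apply: continuous_pair; first by move=> p; exact: cvg_fst.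
    by apply: (@continuous_compose _ _ _ snd fst) => p; [exact: cvg_snd|exact: cvg_fst].
  by apply: (@continuous_compose _ _ _ snd snd) => p; exact: cvg_snd.
have T1 := compact_tube (0 : V) (@velocity_ball_compact R n Omega Omega_compact rad) cF e0.
have T2 := flow_uniform Omega_compact tau_action cw e0.
have [r0 /= r00 hr0] := proj1 (nbhs_normP (0 : V) _) (filterI T1 T2).
pose r := r0 / 2.
have rp : 0 < r by rewrite divr_gt0.
have hr (s : R) : 0 <= s <= 1 ->
    (forall v om, `|v| <= rad -> `|L (s *: (r *: basis i)) v om - L 0 v om| < e') /\
    (forall om, `|w (tau (s *: (r *: basis i)) om) - w om| < e').
  move=> /andP[s0 s1].
  have br : ball_ (fun x : V => `|x|) 0 r0 (s *: (r *: basis i)).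
    rewrite /ball_/= sub0r normrN scalerA normrZ.
    have d1 : `|basis i| <= 1.
      by apply: row_norm_le => // j; rewrite mxE; case: (_ && _); rewrite ?normr1 ?normr0.
    apply: (@le_lt_trans _ _ (r * 1)); last by rewrite mulr1 /r; lra.
    have sr : `|s * r| <= r.
      by rewrite ger0_norm ?ler_piMl// ?mulr_ge0// ltW.
    exact: ler_pM.
  have [h1 h2] := hr0 _ br; split => // v om vr; exact: (h1 (v, om)).
pose d := r *: basis i.
pose w' := mean_along tau d w.
have cw' : continuous w' by exact: mean_along_continuous.
exists w'; split => //.
- move=> om; suff /andP[] : 0 <= w' om <= w om + e' by [].
  apply: mean_along_bounds => // s s01; rewrite w0/=.
  by have := (hr s s01).2 om; rewrite ltr_norml => /andP[]; lra.
- move=> om; rewrite ler_distl; apply: mean_along_bounds => // s s01.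
  by have := (hr s s01).2 om; rewrite ltr_norml => /andP[? ?]; apply/andP; lra.
- move=> om v t vr tt.
  have cwt : continuous (fun om => w (tau (t *: v) om)).
    by apply: (@continuous_compose _ _ _ (tau (t *: v)) w) => //; exact: continuous_flow_at.
  have E : w' om - (1 - alpha * t) * w' (tau (t *: v) om) =
      mean_along tau d (fun om => - (1 - alpha * t) * w (tau (t *: v) om) + w om) om.
    by rewrite mean_along_linear// -mean_along_flow// /w'; ring.
  rewrite -lerBlDr E.
  have cl : continuous (fun om => - (1 - alpha * t) * w (tau (t *: v) om) + w om).
    by apply: continuous_add => //; apply: continuous_mul => //; exact: cst_continuous.
  have [c c0 hc] := compact_bounded_above Omega_compact cl.
  (* The lower bound [- c] carries no information: it is there because the estimate of means is
     two-sided. *)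
  suff /andP[] : - c <= mean_along tau d (fun om => - (1 - alpha * t) * w (tau (t *: v) om) + w om) om
    <= t * (L 0 v om + (e + e')) + M * t ^+ 2 by [].
  apply: mean_along_bounds => // s s01; apply/andP; split.
    by have := hc (tau (s *: d) om) I; rewrite ler_norml => /andP[].
  have := sw (tau (s *: d) om) v t vr tt; rewrite (lag_orbit L_lag).
  have := (hr s s01).1 v om vr; rewrite -/d ltr_norml => /andP[_ h1] h2.
  have /andP[tp _] := tt.
  have : t * (L (s *: d) v om + e) <= t * (L 0 v om + (e + e')).
    by rewrite ler_pM2l//; lra.
  by move: h2; lra.
- split; first by eexists; exact: flow_derivative_mean_along.
  by move=> j g jg; eexists; exact: mean_along_flow_derivative jg.
Qed.

Lemma smoothing_seq (s : seq 'I_n) (e : R) (w : Omega -> R) : 0 < e ->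
  continuous w -> (forall om, 0 <= w om) -> subsol 0 w ->
  exists w' : Omega -> R, [/\ continuous w', forall om, 0 <= w' om,
    forall om, `|w' om - w om| <= e, subsol e w' &
    forall i, i \in s -> exists g, flow_derivative tau (basis i) w' g].
Proof.
move=> e0 cw w0 sw; elim: s e e0 => [|i s IHs] e e0.
  exists w; split => //.
    by move=> om; rewrite subrr normr0 ltW.
  move=> om v t vr tt; apply: le_trans (sw om v t vr tt) _.
  have /andP[tp _] := tt.
  by rewrite !lerD2r ler_pM2l// lerD2l ltW.
have e20 : 0 < e / 2 by rewrite divr_gt0.
have [w1 [cw1 w10 w1w sw1 w1s]] := IHs _ e20.
have [w2 [cw2 w20 w2w sw2 [w2i w2j]]] := smoothing_step i e20 cw1 w10 sw1.
exists w2; split => //.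
- move=> om; have := w1w om; have := w2w om.
  by rewrite !ler_norml => /andP[? ?] /andP[? ?]; apply/andP; lra.
- by rewrite (splitr e).
- move=> j; rewrite inE => /orP[/eqP ->//|/w1s[g]]; exact: w2j.
Qed.

(** For [|v| <= rad] the increment form is divided by [t]. The velocities plus and minus each basis
    vector then bound every component of the gradient by [c + 1]. For larger [v], one part of the
    growth constant, [n%:R * (c + 1)], dominates the pairing with the gradient, and the other,
    [c + 1], dominates [alpha * phi]. *)
Lemma smooth_approximation (e c : R) (w : Omega -> R) : 0 < e <= 1 ->
  alpha * e <= 1 -> 1 <= rad -> 0 <= c ->
  (forall v om, `|v| <= 1 -> L 0 v om <= c) ->
  (forall v om, rad <= `|v| -> (n%:R * (c + 1) + (c + 1)) * `|v| <= L 0 v om) ->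
  continuous w -> (forall om, 0 <= w om) -> (forall om, alpha * w om <= c) -> subsol 0 w ->
  exists phi, [/\ C1s tau phi, forall om, `|phi 0 om - w om| <= e &
    forall v om, alpha * phi 0 om - dotv v (grad (phi^~ om) 0) <= L 0 v om + e].
Proof.
move=> /andP[e0 e1] ae rad1 c0 hc hsup cw w0 wc sw.
have [f [cf f0 fw sf fi]] := smoothing_seq (index_enum 'I_n) e0 cw w0 sw.
have /choice[g0 hg0] : forall i, exists g, flow_derivative tau (basis i) f g.
  by move=> i; apply: fi; exact: mem_index_enum.
pose g om : V := \row_i g0 i om.
have fg i : flow_derivative tau (delta_mx ord0 i) f (fun om => g om ord0 i).
  have -> : (fun om => g om ord0 i) = g0 i by apply/funext => om; rewrite mxE.
  exact: hg0.
have C1 := flow_C1s Omega_compact tau_action cf fg.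
have gradE om : grad ((fun x om => f (tau x om))^~ om) 0 = g om.
  exact: (flow_grad Omega_compact tau_action cf fg).
have f0E om : f (tau 0 om) = f om by case: tau_action => _ _ ->.
have small v om : `|v| <= rad -> alpha * f om - dotv v (g om) <= L 0 v om + e.
  move=> vr; apply/ler_addgt0Pr => k k0.
  have v1 : 0 < `|v| + 1 by rewrite ltr_wpDl.
  pose k1 := k / 3 / (`|v| + 1).
  have k10 : 0 < k1 by rewrite !divr_gt0.
  have k30 : 0 < k / 3 / alpha by rewrite !divr_gt0.
  have T1 := flow_differential Omega_compact tau_action cf fg k10.
  have T2 := flow_uniform Omega_compact tau_action cf k30.
  have [r /= r0 hr] := proj1 (nbhs_normP (0 : V) _) (filterI T1 T2).
  (* The three bounds make [t] an admissible step, keep [t *: v] within [r], and give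
     [M * t <= k / 3]. The other two thirds of [k] pay for the differential of [f] and for the
     variation of [alpha * f]. *)
  pose t := Num.min (2 * alpha)^-1 (Num.min (r / 2 / (`|v| + 1)) (k / 3 / (M + 1))).
  have M1 : 0 < M + 1 by rewrite ltr_wpDl.
  have tp : 0 < t by rewrite !lt_min invr_gt0 mulr_gt0//= !divr_gt0.
  have tt : t <= (2 * alpha)^-1 by rewrite ge_min lexx.
  have tr : t * `|v| < r.
    have : t <= r / 2 / (`|v| + 1) by rewrite !ge_min lexx !orbT.
    rewrite ler_pdivlMr// mulrDr mulr1 => h; have := ltW tp.
    by move: h r0 tp; lra.
  have tM : M * t <= k / 3.
    have : t <= k / 3 / (M + 1) by rewrite !ge_min lexx !orbT.
    by rewrite ler_pdivlMr//; move: tp; lra.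
  have br : ball_ (fun x : V => `|x|) 0 r (t *: v).
    by rewrite /ball_/= sub0r normrN normrZ gtr0_norm.
  have [h1 h2] := hr _ br.
  have := h1 om; rewrite dotvZl normrZ (gtr0_norm tp) ler_norml => /andP[_ {}h1].
  have := h2 om; rewrite ltr_norml => /andP[{}h2 _].
  have h3 := sf om v t vr (introT andP (conj tp tt)).
  have kv : k1 * `|v| <= k / 3.
    rewrite /k1 mulrAC ler_pdivrMr// ler_pM2l ?divr_gt0// lerDl ler01 //.
  have tkv : k1 * (t * `|v|) <= t * (k / 3).
    by rewrite mulrCA ler_pM2l.
  have aF : alpha * f om - k / 3 <= alpha * f (tau (t *: v) om).
    have := ltW h2; rewrite -(ler_pM2l alpha_gt0) mulrN [alpha * (k / 3 / alpha)]mulrC divfK ?gt_eqF//.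
    by rewrite mulrBr; lra.
  have tM' : t * (M * t) <= t * (k / 3) by rewrite ler_pM2l.
  have taF : t * (alpha * f om - k / 3) <= t * (alpha * f (tau (t *: v) om)).
    by rewrite ler_pM2l.
  rewrite -(ler_pM2l tp).
  by move: h1 h3 tkv tM' taF; rewrite expr2; lra.
exists (fun x om => f (tau x om)); split => //.
- by move=> om; rewrite f0E.
- move=> v om; rewrite f0E gradE.
  have [vr|rv] := leP `|v| rad; first exact: small.
  have fc : alpha * f om <= c + 1.
    have := fw om; rewrite ler_norml => /andP[_ h].
    have : alpha * (f om - w om) <= alpha * e by rewrite ler_pM2l.
    by have := wc om; rewrite mulrBr; lra.
  have gc i : `|g om ord0 i| <= c + 1.
    have bi : `|basis i| <= 1.
      by apply: row_norm_le => // j; rewrite mxE; case: (_ && _); rewrite ?normr1 ?normr0.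
    have af0 : 0 <= alpha * f om by rewrite mulr_ge0// ltW.
    have s1 := small (basis i) om (le_trans bi rad1).
    have bi' : `|-1 *: basis i| <= 1 by rewrite scaleN1r normrN.
    have s2 := small (-1 *: basis i) om (le_trans bi' rad1).
    rewrite dotvZl in s2.
    rewrite !dotv_delta in s1 s2.
    have c1 := hc (basis i) om bi.
    have c2 := hc (-1 *: basis i) om bi'.
    by rewrite ler_norml; apply/andP; lra.
  have := dotv_le v gc; rewrite ler_norml => /andP[h1 _].
  have v1 : 1 <= `|v| by rewrite (le_trans rad1)// ltW.
  have h2 := hsup v om (ltW rv).
  have h3 : c + 1 <= (c + 1) * `|v| by rewrite ler_peMr// addr_ge0.
  by move: h1 h2 h3 fc; lra.
Qed.

End Smoothing.

(** * Holonomic measures *)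

HB.instance Definition _ (T U : ptopologicalType) := Pointed.on (T * U)%type.

Section ClosedFunctional.
Context {R : realType} {n : nat} {Omega : pmetricType R}.
Local Notation V := 'rV[R]_n.
Variables (tau : V -> Omega -> Omega) (L : V -> V -> Omega -> R) (alpha : R).
Hypothesis Omega_compact : compact [set: Omega].
Hypothesis L_lag : lagrangian tau L.
Variables (rad : R) (u : Omega -> R).
Hypothesis rad_ge0 : 0 <= rad.
Hypothesis u_continuous : continuous u.
Hypothesis u_maximal : forall (c : R) (psi : V -> Omega -> R), 0 < c -> C1s tau psi ->
  (forall v om, `|v| <= rad ->
    alpha * u om + c - dotv v (grad (psi^~ om) 0) <= L 0 v om) -> False.

Let X := [set p : V * Omega | `|p.1| <= rad].
Let E : lmodType R := (V * Omega)%type -> R^o.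
Let P : set E := [set f | continuous (f : V * Omega -> R)].
Let gap (p : V * Omega) : R := L 0 p.1 p.2 - alpha * u p.2.
Let pairing (phi : V -> Omega -> R) (p : V * Omega) : R :=
  dotv p.1 (grad (phi^~ p.2) 0).

(* [inf (bounds f)] is the infimum over [phi] and [s >= 0] of the supremum of
   [f + v . D phi - s gap] on [X]; a linear functional below it annihilates the
   pairings and is nonpositive on [gap]. *)
Let bounds (f : E) : set R := [set a | exists phi (s : R), [/\ C1s tau phi, 0 <= s &
  forall p, X p -> f p + (pairing phi p - s * gap p) <= a]].

Let pairing_lin (a : R) phi psi p : C1s tau phi -> C1s tau psi ->
  pairing (fun x w => a * phi x w + psi x w) p = a * pairing phi p + pairing psi p.
Proof.
by move=> C1 C2; rewrite /pairing (grad_lin a p.2 C1 C2) dotvC dotvDl dotvZl !(dotvC p.1).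
Qed.

Let pairing_cst c p : pairing (fun _ _ => c) p = 0.
Proof. by rewrite /pairing grad_cst /dotv big1// => i _; rewrite mxE mulr0. Qed.

Let C1s0 : C1s tau (fun _ _ => 0 : R).
Proof. exact: C1s_cst. Qed.

(** Maximality of [u] enters here. For [s > 0] a negative [b] would make [psi = - phi / s] and
    [c = - b / s] violate it; for [s = 0] the pairing vanishes at zero velocity. Consequently the
    infimum of [bounds f] is finite. *)
Let gap_ge0 phi (s b : R) : C1s tau phi -> 0 <= s ->
  (forall p, X p -> pairing phi p - s * gap p <= b) -> 0 <= b.
Proof.
move=> C1 s0 hb; rewrite leNgt; apply/negP => b0.
move: s0; rewrite le_eqVlt => /orP[/eqP s0|s0].
  have := hb (0, point); rewrite /X/= normr0 => /(_ rad_ge0).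
  rewrite -s0 mul0r subr0 /pairing/= /dotv big1.
    by rewrite leNgt b0.
  by move=> i _; rewrite mxE mul0r.
have c0 : 0 < - b / s by rewrite divr_gt0// oppr_gt0.
have C1' := C1s_lin (- s^-1) C1 C1s0.
apply: (u_maximal c0 C1') => v om vr.
have := hb (v, om) vr.
rewrite -[dotv _ _]/(pairing (fun x w => - s^-1 * phi x w + 0) (v, om)).
rewrite pairing_lin// pairing_cst /gap/= => h.
rewrite -(ler_pM2l s0).
have -> : s * (alpha * u om + - b / s - (- s^-1 * pairing phi (v, om) + 0)) =
    s * (alpha * u om) - b + pairing phi (v, om) by field; rewrite gt_eqF.
by move: h; lra.
Qed.

Let P0 : P 0. Proof. exact: (@cst_continuous (V * Omega)%type R 0). Qed.

Let PD a f g : P f -> P g -> P (a *: f + g).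
Proof.
move=> Pf Pg; apply: (@continuous_add _ _ (fun p => a * f p) g) => //.
by apply: continuous_mul => //; exact: cst_continuous.
Qed.

Let has_inf_bounds f : P f -> has_inf (bounds f).
Proof.
move=> Pf; have [c c0 hc] := compact_bounded_above (velocity_ball_compact Omega_compact (r := rad)) Pf.
split.
  exists c, (fun _ _ => 0), 0; split => // p Xp.
  rewrite pairing_cst mul0r subr0 addr0; apply: le_trans (hc p Xp); exact: ler_norm.
exists (- c) => a [phi [s [C1 s0 h]]].
rewrite -subr_ge0 opprK; apply: (gap_ge0 C1 s0) => p Xp.
by have := h p Xp; have := hc p Xp; rewrite ler_norml => /andP[]; lra.
Qed.

Let sublinear_bounds : sublinear P (fun f => inf (bounds f)).
Proof.
apply: (inf_sublinear P0 PD) => //.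
- move=> f g a b Pf Pg [phi [s [C1 s0 h1]]] [psi [t [C2 t0 h2]]].
  exists (fun x w => 1 * phi x w + psi x w), (s + t); split.
  + exact: C1s_lin.
  + exact: addr_ge0.
  + move=> p Xp; rewrite pairing_lin// mul1r -[(f + g) p]/(f p + g p).
    by have := h1 p Xp; have := h2 p Xp; lra.
- move=> c f a c0 Pf [phi [s [C1 s0 h]]].
  exists (fun x w => c * phi x w + 0), (c * s); split.
  + exact: C1s_lin.
  + by rewrite mulr_ge0// ltW.
  + move=> p Xp; rewrite pairing_lin// pairing_cst addr0 -[(c *: f) p]/(c * f p).
    have := h p Xp; rewrite -(ler_pM2l c0); lra.
Qed.

(** Each property is read off a suitable element of [bounds]: the test function [- phi] cancels
    [pairing phi], and [s = 1] cancels [gap]. Applying the former to [phi] and [- phi] gives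
    equality. Only points of [X] enter [bounds], so positivity is relative to [X]. *)
Theorem closed_functional : exists Lam : (V * Omega -> R) -> R,
  [/\ forall (a : R) (f g : V * Omega -> R), continuous f -> continuous g ->
        Lam (fun x => a * f x + g x) = a * Lam f + Lam g,
      forall f g : V * Omega -> R, continuous f -> continuous g ->
        (forall x, X x -> f x <= g x) -> Lam f <= Lam g,
      Lam (fun=> 1) = 1,
      forall phi, C1s tau phi -> Lam (pairing phi) = 0 & Lam gap <= 0].
Proof.
have [q [qlin qle]] := hahn_banach_sublinear P0 PD sublinear_bounds.
have q_ub (f : V * Omega -> R) a : continuous f -> bounds f a -> q f <= a.
  move=> cf ba; apply: le_trans (qle f cf) _; apply: ge_inf => //.
  exact: (has_inf_bounds cf).2.
have qD (a : R) (f g : V * Omega -> R) : continuous f -> continuous g ->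
  q (fun x => a * f x + g x) = a * q f + q g by exact: qlin.
have q_le (f : V * Omega -> R) a : continuous f -> (forall p, X p -> f p <= a) -> q f <= a.
  move=> cf fa; apply: q_ub => //; exists (fun _ _ => 0), 0; split => // p Xp.
  by rewrite pairing_cst mul0r subr0 addr0; exact: fa.
have c_cst (a : R) : continuous (fun _ : V * Omega => a) by exact: cst_continuous.
have q0 : q (fun=> 0) = 0.
  have := qD 1 _ _ (c_cst 0) (c_cst 0).
  by under [X in q X]eq_fun do rewrite mulr0 addr0; lra.
have qZ (a : R) f : continuous f -> q (fun x => a * f x) = a * q f.
  move=> cf; have := qD a f _ cf (c_cst 0).
  by under [X in q X]eq_fun do rewrite addr0; rewrite q0 addr0.
have cpair phi : C1s tau phi -> continuous (pairing phi) by exact: C1s_pairing_continuous.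
have cgap : continuous gap.
  apply: continuous_add; first exact: (lag_continuous0 L_lag).
  have -> : (fun p : V * Omega => - (alpha * u p.2)) = (fun p => - alpha * u p.2).
    by apply/funext => p; rewrite mulNr.
  apply: continuous_mul => //.
  by apply: (@continuous_compose _ _ _ snd u) => // p; exact: cvg_snd.
have q_pair phi : C1s tau phi -> q (pairing phi) <= 0.
  move=> C1; apply: q_ub; first exact: cpair.
  exists (fun x w => -1 * phi x w + 0), 0; split => //; first exact: C1s_lin.
  by move=> p Xp; rewrite pairing_lin// pairing_cst mul0r; lra.
exists q; split => //.
- move=> f g cf cg fg.
  have := qD (-1) g f cg cf.
  have : q (fun x => -1 * g x + f x) <= 0.
    apply: q_le => [|p /fg]; last by lra.
    by apply: continuous_add => //; exact: continuous_mul.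
  by move=> h E'; move: h; rewrite E'; lra.
- apply/eqP; rewrite eq_le; apply/andP; split; first exact: q_le.
  have : q (fun x => -1 * 1) <= -1 by apply: q_le => // p _; rewrite mulr1.
  by rewrite (qZ (-1) (fun=> 1))//; lra.
- move=> phi C1; apply/eqP; rewrite eq_le q_pair//=.
  have := q_pair _ (C1s_lin (-1) C1 C1s0).
  have -> : pairing (fun x w => -1 * phi x w + 0) = (fun p => -1 * pairing phi p).
    by apply/funext => p; rewrite pairing_lin// pairing_cst addr0.
  by rewrite qZ; [lra|exact: cpair].
- apply: q_ub => //; exists (fun _ _ => 0), 1; split => // p Xp.
  by rewrite pairing_cst; lra.
Qed.

End ClosedFunctional.

(** * Action bounds and the minimizing measure *)

(** The left-hand side of the differential inequality is the negative of the constraint integrand,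
    so its integral against [mu] is [alpha * I]. *)
Lemma action_lower_bound (R : realType) (n : nat) (Omega : pmetricType R)
    (tau : 'rV[R]_n -> Omega -> Omega) (L : 'rV[R]_n -> 'rV[R]_n -> Omega -> R)
    (alpha e : R) (nu : probability (borel Omega) R)
    (mu : probability (borel ('rV[R]_n * Omega)%type) R) (phi : 'rV[R]_n -> Omega -> R) (I : R) :
  lagrangian tau L -> discounted_constraint tau alpha nu mu -> C1s tau phi ->
  (\int[nu]_w (phi 0 w)%:E = I%:E)%E ->
  (forall v om, alpha * phi 0 om - dotv v (grad (phi^~ om) 0) <= L 0 v om + e) ->
  ((alpha * I - e)%:E <= action_value L mu)%E.
Proof.
move=> lagL cmu C1 intI sub.
have [iF EF] := cmu _ C1.
set F := (fun p : 'rV[R]_n * Omega => _) in iF EF.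
have mL : measurable_fun [set: borel ('rV[R]_n * Omega)%type]
    (fun p : borel ('rV[R]_n * Omega)%type => L 0 (p : 'rV[R]_n * Omega).1 (p : 'rV[R]_n * Omega).2).
  exact: (continuous_borel_measurable (lag_continuous0 lagL)).
have L0 (p : 'rV[R]_n * Omega) : 0 <= L 0 p.1 p.2 by exact: lag_ge0 lagL _ _ _.
rewrite /action_value.
(* Infinite action satisfies the bound; finite action makes the nonnegative [L] integrable, so that
   integrals can be compared. *)
have [fin|inf] := ltP (\int[mu]_p (L 0 (p : 'rV[R]_n * Omega).1 (p : 'rV[R]_n * Omega).2)%:E)%E +oo%E; last first.
  by apply: le_trans inf; exact: leey.
have iL : mu.-integrable setT (fun p : borel ('rV[R]_n * Omega)%type =>
    (L 0 (p : 'rV[R]_n * Omega).1 (p : 'rV[R]_n * Omega).2)%:E).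
  apply/integrableP; split; first exact/measurable_EFinP.
  by under eq_integral do rewrite gee0_abs ?lee_fin//.
have ie : mu.-integrable setT (fun=> e%:E).
  exact: (@bounded_continuous_integrable _ _ mu (fun=> e) `|e| (@cst_continuous _ _ e)).
have iNF : mu.-integrable setT (fun p => (- F p)%E) by exact: integrableN.
apply: (@le_trans _ _ (\int[mu]_p ((- F p) - e%:E))%E); last first.
  apply: le_integral => //; first exact: integrableB.
  move=> p _; rewrite /F -EFinN -EFinB lee_fin.
  by have := sub (p : 'rV[R]_n * Omega).1 (p : 'rV[R]_n * Omega).2; lra.
have ce : (\int[mu]_p e%:E = e%:E)%E.
  have := integral_cst mu measurableT e%:E.
  by rewrite [X in (_ * X)%E](probability_setT mu) mule1.
rewrite integralB// ce.
rewrite (integralN (integrable_add_def measurableT iF)).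
rewrite EF intI -EFinM -EFinN -EFinB lee_fin; lra.
Qed.

Theorem theorem8 (R : realType) (n : nat) (Omega : pmetricType R)
    (tau : 'rV[R]_n -> Omega -> Omega)
    (L : 'rV[R]_n -> 'rV[R]_n -> Omega -> R) (alpha : R)
    (Omega_compact : compact [set: Omega])
    (tau_action : continuous_action tau)
    (tau_transitive : uniformly_transitive tau)
    (L_lagrangian : lagrangian tau L)
    (alpha_gt0 : 0 < alpha) :
  exists (nu : probability (borel Omega) R)
         (mu : probability (borel ('rV[R]_n * Omega)%type) R),
    discounted_mather tau L alpha nu mu /\
    forall phi : 'rV[R]_n -> Omega -> R, C1s tau phi ->
      (\int[mu]_p (phi 0 (p : 'rV[R]_n * Omega).2)%:E =
       \int[nu]_w (phi 0 w)%:E)%E.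
Proof.
have [c c0 hc] := lag_bounded Omega_compact L_lagrangian 1.
have [rad rad1 hrad] := lag_superlinear_uniform Omega_compact L_lagrangian (n%:R * (c + 1) + (c + 1)).
have rad0 : 0 <= rad by exact: le_trans rad1.
have [CL CL0 hCL] := lag_bounded Omega_compact L_lagrangian rad.
have [C hC] := lag_growth L_lagrangian.
(* A Lipschitz constant of [L] along rays of velocity at most [rad], taken from the growth
   condition; the factor [n] converts the sup norm into the Euclidean one. *)
pose ML := n%:R * rad * (`|C| + `|C| * CL).
have ML0 : 0 <= ML by rewrite !mulr_ge0// addr_ge0// mulr_ge0.
have hML v om (s : R) : 0 <= s <= (2 * alpha)^-1 -> `|v| <= rad ->
    L (s *: v) v om <= L 0 v om + s * ML.
  move=> /andP[s0 _] vr; have := hC 0 (s *: v) v om; rewrite add0r.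
  have L0 := lag_ge0 L_lagrangian 0 v om; have LC := hCL v om vr.
  have h1 : enorm (s *: v) <= s * (n%:R * rad).
    apply: le_trans (enorm_le _) _; rewrite normrZ ger0_norm// mulrCA.
    by rewrite ler_wpM2l// ler_wpM2l.
  have h2 : C + C * L 0 v om <= `|C| + `|C| * CL.
    apply: lerD; first exact: ler_norm.
    apply: (@le_trans _ _ (`|C| * L 0 v om)); first by rewrite ler_wpM2r// ler_norm.
    by rewrite ler_wpM2l.
  have h3 : enorm (s *: v) * (C + C * L 0 v om) <= s * (n%:R * rad) * (`|C| + `|C| * CL).
    apply: (@le_trans _ _ (enorm (s *: v) * (`|C| + `|C| * CL))).
      by rewrite ler_wpM2l// sqrtr_ge0.
    by rewrite ler_wpM2r// addr_ge0// mulr_ge0.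
  by rewrite /ML; move: h3; lra.
pose M := 2 * (ML + alpha * CL).
have M0 : 0 <= M by rewrite mulr_ge0// addr_ge0// mulr_ge0// ltW.
pose u := value tau L alpha rad M.
have hc0 om : L 0 0 om <= c by apply: hc; rewrite normr0.
have cu : continuous u by exact: value_continuous.
have u0 om : 0 <= u om by exact: value_ge0.
have uc om : alpha * u om <= c by exact: value_le.
have usub : subsolution tau L alpha rad M 0 u by exact: value_subsolution.
have umax (k : R) (psi : 'rV[R]_n -> Omega -> R) : 0 < k -> C1s tau psi ->
    (forall v om, `|v| <= rad ->
      alpha * u om + k - dotv v (grad (psi^~ om) 0) <= L 0 v om) -> False.
  move=> k0 C1 h.
  exact: (@value_maximal R n Omega tau L alpha Omega_compact tau_action L_lagrangian alpha_gt0
    rad M rad1 M0 CL ML k psi hCL hML CL0 ML0 erefl k0 C1 h).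
have [Lam [Llin Lle L1 Lpair Lgap]] := closed_functional Omega_compact L_lagrangian rad0 cu umax.
have csnd (f : Omega -> R) : continuous f -> continuous (fun p : 'rV[R]_n * Omega => f p.2).
  by move=> cf; apply: (@continuous_compose _ _ _ snd f) => // p; exact: cvg_snd.
have [mu hmu] := riesz_representation
  (velocity_ball_compact Omega_compact (r := rad)) (@open_exhaustion R ('rV[R]_n * Omega)%type) Llin Lle L1.
(* The trace is obtained by representing the same functional on functions of the second variable;
   the holonomy identity is then immediate. *)
have [nu hnu] : exists nu : probability (borel Omega) R, forall f : Omega -> R, continuous f ->
    nu.-integrable setT (fun x => (f x)%:E) /\
    (\int[nu]_x (f x)%:E = (Lam (fun p => f p.2))%:E)%E.
  apply: (@riesz_representation R Omega (fun f => Lam (fun p => f p.2)) setT Omega_compact).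
  - exact: open_exhaustion.
  - by move=> a f g cf cg; apply: Llin; exact: csnd.
  - by move=> f g cf cg fg; apply: Lle => [||p _]; [exact: csnd..|exact: fg].
  - exact: L1.
exists nu, mu; split; last first.
  move=> phi C1; have cphi : continuous (phi 0) by exact: (C1s_continuous C1).
  by have [_ ->] := hmu _ (csnd _ cphi); have [_ ->] := hnu _ cphi.
split.
  move=> phi C1 F; have cphi : continuous (phi 0) by exact: (C1s_continuous C1).
  have cpair := C1s_pairing_continuous C1.
  have E : (fun p : 'rV[R]_n * Omega => dotv p.1 (grad (phi^~ p.2) 0) - alpha * phi 0 p.2) =
      (fun p => - alpha * phi 0 p.2 + dotv p.1 (grad (phi^~ p.2) 0)).
    by apply/funext => p; ring.
  have cF : continuous (fun p : 'rV[R]_n * Omega =>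
      dotv p.1 (grad (phi^~ p.2) 0) - alpha * phi 0 p.2).
    rewrite E; apply: continuous_add => //; apply: continuous_mul; last exact: csnd.
    exact: cst_continuous.
  have [iF EF] := hmu _ cF.
  split; first exact: iF.
  rewrite EF E Llin//; last exact: csnd.
  by have [_ ->] := hnu _ cphi; rewrite Lpair// addr0.
move=> mu' cmu'.
have [_ EL] := hmu _ (lag_continuous0 L_lagrangian).
rewrite {1}/action_value EL; apply/lee_addgt0Pr => e e0.
have a1 : 0 < alpha + 1 by rewrite addr_gt0.
(* Approximating [u] within [k'] costs [alpha * k'] in the integral of [alpha * u] and [k'] in the
   inequality with [L], hence the divisor [alpha + 1]. The caps 1 and [alpha^-1] are those required
   for the smoothing. *)
pose k := Num.min 1 (e / (alpha + 1)).
have k0 : 0 < k by rewrite lt_min ltr01 divr_gt0.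
have k1 : k <= 1 by rewrite ge_min lexx.
have ke : (alpha + 1) * k <= e by rewrite -ler_pdivlMl// mulrC ge_min lexx orbT.
pose k' := Num.min k alpha^-1.
have k'0 : 0 < k' by rewrite lt_min k0 invr_gt0.
have k'k : k' <= k by rewrite ge_min lexx.
have k'a : alpha * k' <= 1 by rewrite -ler_pdivlMl// mulr1 ge_min lexx orbT.
have k'1 : 0 < k' <= 1 by rewrite k'0 (le_trans k'k).
have [phi [C1 phiu sub]] := smooth_approximation Omega_compact tau_action L_lagrangian alpha_gt0 M0
  k'1 k'a rad1 c0 hc hrad cu u0 uc usub.
have cphi : continuous (phi 0) by exact: (C1s_continuous C1).
have [_ Enu] := hnu _ cphi.
have lb := action_lower_bound L_lagrangian cmu' C1 Enu sub.
apply: le_trans (leeD2r e%:E lb); rewrite -EFinD lee_fin.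
have cu2 := csnd _ cu.
have cL := lag_continuous0 L_lagrangian.
(* Nonpositivity on the gap bounds the action of [mu] above by the integral of [alpha * u] against
   [nu], up to [e] the lower bound valid for every competitor. *)
have LamL : Lam (fun p => L 0 p.1 p.2) <= alpha * Lam (fun p => u p.2).
  have := Llin (- alpha) _ _ cu2 cL.
  have -> : (fun x : 'rV[R]_n * Omega => - alpha * u x.2 + L 0 x.1 x.2) =
      (fun p => L 0 p.1 p.2 - alpha * u p.2) by apply/funext => p; ring.
  by move=> E; move: Lgap; rewrite E; lra.
have Lamu : Lam (fun p => u p.2) <= Lam (fun p => phi 0 p.2) + k'.
  have E : k' * Lam (fun=> 1) + Lam (fun p => phi 0 p.2) =
      Lam (fun p => k' * 1 + phi 0 p.2).
    by rewrite (Llin k' (fun=> 1))//; [exact: cst_continuous|exact: csnd].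
  have <- : Lam (fun p => k' * 1 + phi 0 p.2) = Lam (fun p => phi 0 p.2) + k'.
    by rewrite -E L1 mulr1 addrC.
  apply: Lle => //.
    apply: continuous_add; [exact: cst_continuous|exact: csnd].
  by move=> p _; have := phiu p.2; rewrite mulr1 ler_norml => /andP[]; lra.
have h : alpha * Lam (fun p => u p.2) <= alpha * (Lam (fun p => phi 0 p.2) + k').
  by rewrite ler_pM2l.
have h' : (alpha + 1) * k' <= (alpha + 1) * k by rewrite ler_pM2l.
by move: LamL h h' ke; lra.
Qed.
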